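(* Let $d\ge 0$ be an integer. Suppose that for some constant $\beta\ge 1$ there is a polynomial-time algorithm which, given any graph $G$ with $\mathrm{tww}(G)\le d$, outputs an independent set of $G$ of size at least $\alpha(G)/\beta$. Then for every $\varepsilon>0$ there is a polynomial-time algorithm which, given any graph $G$ with $\mathrm{tww}(G)\le d$, outputs an independent set of $G$ of size at least $\alpha(G)/(1+\varepsilon)$.
   Context: $\alpha(G)$ is the maximum size of an independent set of $G$. A trigraph $H$ consists of a vertex set $V(H)$ and two disjoint sets of unordered pairs of distinct vertices: black edges $E(H)$ and red edges $R(H)$. Two vertices are adjacent (neighbors) if they are joined by a black or a red edge. The red graph of $H$ is the graph $(V(H),R(H))$; $H$ is a $d$-trigraph if its red graph has maximum degree at most $d$. A graph is a trigraph with no red edges. Contracting two distinct vertices $u,v$ of a trigraph $H$ yields the trigraph obtained by deleting $u$ and $v$ and adding a new vertex $z$ such that, for every other vertex $x$: $zx$ is a black edge if both $ux$ and $vx$ are black edges; $zx$ is not an edge if $x$ is adjacent to neither $u$ nor $v$; and $zx$ is a red edge otherwise. All edges not incident to $u$ or $v$ are unchanged. A $d$-sequence of an $n$-vertex graph $G$ is a sequence of $d$-trigraphs $G=G_n,G_{n-1},\dots,G_1$ such that $G_1$ has a single vertex and each $G_{i-1}$ is obtained from $G_i$ by one contraction (so $G_i$ has $i$ vertices). The twin-width $\mathrm{tww}(G)$ of $G$ is the minimum $d$ such that $G$ admits a $d$-sequence. *)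

(* Defs.v *)
From mathcomp Require Import all_boot.
From Stdlib Require Import Reals.
Set Implicit Arguments.
Unset Strict Implicit.
Unset Printing Implicit Defensive.

Definition is_graph (n : nat) (adj : rel 'I_n) : Prop :=
  symmetric adj /\ irreflexive adj.

Definition independent (n : nat) (adj : rel 'I_n) (S : {set 'I_n}) : bool :=
  [forall x in S, forall y in S, ~~ adj x y].

Definition alpha (n : nat) (adj : rel 'I_n) : nat :=
  \max_(S : {set 'I_n} | independent adj S) #|S|.

(* Trigraphs over a finite label type T: vertex set V, black edges     *)
(* and red edges given as relations (only pairs of distinct vertices   *)
(* of V are meaningful).                                               *)
Record trigraph (T : finType) := Trigraph {
  tV : {set T};
  tB : rel T;
  tR : rel T }.

Section Trigraphs.
Variable T : finType.

Definition tadj (H : trigraph T) (x y : T) : bool :=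
  [&& x \in tV H, y \in tV H, x != y & tB H x y || tR H x y].

Definition tblack (H : trigraph T) (x y : T) : bool :=
  [&& x \in tV H, y \in tV H, x != y & tB H x y].

Definition tred (H : trigraph T) (x y : T) : bool :=
  [&& x \in tV H, y \in tV H, x != y & tR H x y].

Definition red_deg_le (d : nat) (H : trigraph T) : bool :=
  [forall x in tV H, #|[set y in tV H | tred H x y]| <= d].

(* Contraction of u and v into a new vertex z; z is any label not used by
   the remaining vertices (it may reuse u or v). *)
Definition contract (H : trigraph T) (u v z : T) : trigraph T :=
  let V' := z |: (tV H :\ u :\ v) in
  let bz x := tblack H u x && tblack H v x in
  let rz x := (tadj H u x || tadj H v x) && ~~ bz x in
  Trigraph V'
    (fun x y => [&& x \in V', y \in V', x != y &
        if x == z then bz y else if y == z then bz x else tblack H x y])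
    (fun x y => [&& x \in V', y \in V', x != y &
        if x == z then rz y else if y == z then rz x else tred H x y]).

Inductive has_dseq (d : nat) : trigraph T -> Prop :=
  | dseq_end (H : trigraph T) :
      #|tV H| = 1 -> red_deg_le d H -> has_dseq d H
  | dseq_step (H : trigraph T) (u v z : T) :
      red_deg_le d H -> u \in tV H -> v \in tV H -> u != v ->
      z \notin (tV H :\ u :\ v) ->
      has_dseq d (contract H u v z) -> has_dseq d H.

End Trigraphs.

Definition graph_trigraph (n : nat) (adj : rel 'I_n) : trigraph 'I_n :=
  Trigraph [set: 'I_n] adj (fun _ _ => false).

(* tww(G) <= d  iff  G admits a d-sequence (a d'-sequence with d' <= d is
   a d-sequence). *)
Definition tww_le (n : nat) (adj : rel 'I_n) (d : nat) : Prop :=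
  has_dseq d (graph_trigraph adj).

(* States 'I_k.+1, tape symbols 'I_m.+3 (0 = blank, 1 = bit false,     *)
(* 2 = bit true, others = auxiliary). delta = None means halt.         *)
(* Moves: true = right, false = left.                                  *)
Record TM := MkTM {
  tm_k : nat;
  tm_m : nat;
  tm_start : 'I_tm_k.+1;
  tm_delta : 'I_tm_k.+1 -> 'I_tm_m.+3 -> option ('I_tm_k.+1 * 'I_tm_m.+3 * bool) }.

Section TMsem.
Variable M : TM.
Definition sym := 'I_(tm_m M).+3.
Definition blank : sym := inord 0.
Definition enc_bit (b : bool) : sym := inord (if b then 2 else 1).

(* tape: reversed left part, symbol under head, right part *)
Record tape := Tape { tl : seq sym; thd : sym; tr : seq sym }.
Definition config := ('I_(tm_k M).+1 * tape)%type.

Definition move (right : bool) (t : tape) : tape :=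
  let: Tape l a r := t in
  if right then
    match r with [::] => Tape (a :: l) blank [::] | b :: r' => Tape (a :: l) b r' end
  else
    match l with [::] => Tape [::] blank (a :: r) | b :: l' => Tape l' b (a :: r) end.

Definition step (c : config) : option config :=
  let: (q, Tape l a r) := c in
  match tm_delta q a with
  | None => None
  | Some (q', a', mv) => Some (q', move mv (Tape l a' r))
  end.

Definition halted (c : config) : bool := if step c is None then true else false.

Fixpoint run (t : nat) (c : config) : config :=
  match t with
  | 0 => c
  | t'.+1 => if step c is Some c' then run t' c' else c
  end.

Definition init (w : seq bool) : config :=
  (tm_start M,
   match w with
   | [::] => Tape [::] blank [::]
   | b :: w' => Tape [::] (enc_bit b) (map enc_bit w')
   end).

Fixpoint decode (s : seq sym) : seq bool :=
  match s with
  | [::] => [::]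
  | a :: s' => if val a == 1 then false :: decode s'
               else if val a == 2 then true :: decode s' else [::]
  end.

Definition output (c : config) : seq bool :=
  let: (_, Tape _ a r) := c in decode (a :: r).

Definition halts_within (w : seq bool) (t : nat) (y : seq bool) : Prop :=
  halted (run t (init w)) /\ output (run t (init w)) = y.

End TMsem.

Definition enc_graph (n : nat) (adj : rel 'I_n) : seq bool :=
  flatten [seq [seq adj i j | j <- enum 'I_n] | i <- enum 'I_n].

Definition dec_set (n : nat) (y : seq bool) : {set 'I_n} :=
  [set i : 'I_n | nth false y i].

Definition poly_approx_indep (d : nat) (beta : R) (M : TM) : Prop :=
  exists c : nat,
    forall (n : nat) (adj : rel 'I_n), is_graph adj -> tww_le adj d ->
      exists (t : nat) (y : seq bool),
        t <= c * (size (enc_graph adj)) ^ c + c /\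
        halts_within M (enc_graph adj) t y /\
        independent adj (dec_set n y) /\
        Rle (INR (alpha adj)) (Rmult beta (INR #|dec_set n y|)).

(* Main.v *)
From HB Require Import structures.
Require Import Defs.
From mathcomp Require Import all_boot.
From mathcomp Require Import zify.
From Stdlib Require Import Reals Lra FunctionalExtensionality.
Set Implicit Arguments.
Unset Strict Implicit.
Unset Printing Implicit Defensive.

(**
Let G[G] be the lexicographic square of G. Its twin-width is at most that of G (contract
every copy of G to a vertex, then contract the remaining copy of G), and
alpha(G)^2 <= alpha(G[G]). For an independent set S of G[G], the set of copies met by S and
the trace of S on each copy are independent in G; if m is the largest of their sizes, then
|S| <= m^2. So a beta-approximation on G[G] gives a sqrt(beta)-approximation on G, and
iterating k times replaces beta by beta^(1/2^k), which tends to 1.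

One squaring step is a Turing machine: it is written in a language of stacks with a finite
register, and a stack program is turned into a one-tape machine in which the stacks are
parallel tracks with their bottoms at a home cell. The given machine M is simulated with two
of the stacks as the two halves of its tape.
*)

(** No [d]-sequence is ever computed: [M] is promised to work whenever its input has twin-width at
    most [d], so it suffices that a sequence for G[G] exists. Contracting inside a copy creates no
    red edge leaving it, because every vertex of another copy sees the whole copy alike. Hence the
    bound [d] is kept exactly, and the hypothesis applies again after each squaring. The number of
    squarings depends only on [beta] and [eps], so the composed reductions stay polynomial. Two
    features of the encoding shape the stack program: the input is a bare word of [n * n] bits, from
    which [n] has to be recovered, and the output of [M] may be short and followed by arbitrary tape
    content. One feature of the machine model shapes the compiler: every step moves the head, so
    control cannot be passed by an idle step. *)

(** * Relabelling trigraphs and transporting [d]-sequences *)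

Section TrigraphEmbedding.

Lemma tadjE (T : finType) (H : trigraph T) x y : tadj H x y = tblack H x y || tred H x y.
Proof. by rewrite /tadj /tblack /tred; do 3!case: (X in [&& X & _]) => //=; case: (_ != _). Qed.

(** Stands in for equality of trigraphs, which is too fine: [tB] and [tR] may take any value off the
    vertex set, so colours are compared through [tblack] and [tred]. With [f] the identity it says
    that two records describe the same trigraph. *)
Record embeds (T T' : finType) (f : T -> T') (H : trigraph T) (H' : trigraph T') : Prop := {
  embV : tV H' = f @: tV H;
  embB : {in tV H &, forall x y, tblack H' (f x) (f y) = tblack H x y};
  embR : {in tV H &, forall x y, tred H' (f x) (f y) = tred H x y} }.

Variables (T T' : finType) (f : T -> T').
Hypothesis f_inj : injective f.

Lemma embeds_red_deg d (H : trigraph T) (H' : trigraph T') :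
  embeds f H H' -> red_deg_le d H -> red_deg_le d H'.
Proof.
case=> eV _ eR /forall_inP rd; apply/forall_inP => x'; rewrite eV => /imsetP[x xH ->{x'}].
apply: leq_trans (rd x xH); rewrite -(card_imset _ f_inj); apply: subset_leq_card.
apply/subsetP => _ /[!inE] /andP[/imsetP[y yH ->]]; rewrite eR // => r.
by apply/imsetP; exists y; rewrite // inE yH.
Qed.

(** Colours after a contraction depend only on colours before it, which [f] preserves; injectivity
    makes the tests against [f u], [f v], [f z] agree with those against [u], [v], [z]. *)
Lemma embeds_contract (H : trigraph T) (H' : trigraph T') u v z : u \in tV H -> v \in tV H ->
  embeds f H H' -> embeds f (contract H u v z) (contract H' (f u) (f v) (f z)).
Proof.
move=> uH vH [eV eB eR].
have memE x : (f x \in tV H') = (x \in tV H) by rewrite eV mem_imset.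
have eA x y : x \in tV H -> y \in tV H -> tadj H' (f x) (f y) = tadj H x y.
  by move=> xH yH; rewrite !tadjE eB // eR.
have memC x : (f x \in f z |: (tV H' :\ f u :\ f v)) = (x \in z |: (tV H :\ u :\ v)).
  by rewrite !inE memE !(inj_eq f_inj).
have Vx x : x \in z |: (tV H :\ u :\ v) -> x != z -> x \in tV H.
  by rewrite !inE => /orP[->//|/and3P[]].
split.
- apply/setP => y; apply/idP/imsetP => [|[x xH ->]]; last by rewrite /= memC.
  rewrite /= !inE => /orP[/eqP->|]; first by exists z; rewrite // !inE eqxx.
  rewrite eV => /and3P[yv yu /imsetP[x xH ey]]; exists x => //.
  by rewrite !inE xH -!(inj_eq f_inj) -ey yv yu orbT.
- move=> x y xC yC; rewrite /tblack /= memC memC (inj_eq f_inj) xC yC /=.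
  case: eqP => //= /eqP xy; rewrite !(inj_eq f_inj).
  case: eqP => [xz|/eqP xz]; first by rewrite !eB // Vx // -xz eq_sym.
  case: eqP => [yz|/eqP yz]; first by rewrite !eB // Vx.
  by apply: eB; apply: Vx.
- move=> x y xC yC; rewrite /tred /= memC memC (inj_eq f_inj) xC yC /=.
  case: eqP => //= /eqP xy; rewrite !(inj_eq f_inj).
  case: eqP => [xz|/eqP xz]; first by rewrite !eB ?eA // Vx // -xz eq_sym.
  case: eqP => [yz|/eqP yz]; first by rewrite !eB ?eA // Vx.
  by apply: eR; apply: Vx.
Qed.

Lemma embeds_dseq d (H : trigraph T) (H' : trigraph T') : embeds f H H' -> has_dseq d H -> has_dseq d H'.
Proof.
move=> e h; elim: h H' e => {H} [H cH rd|H u v z rd uH vH uv zH _ IH] H' e.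
  by apply: dseq_end; [rewrite (embV e) card_imset | exact: embeds_red_deg rd].
apply: (dseq_step (u := f u) (v := f v) (z := f z)).
- exact: embeds_red_deg rd.
- by rewrite (embV e) mem_imset.
- by rewrite (embV e) mem_imset.
- by rewrite (inj_eq f_inj).
- by move: zH; rewrite !inE (embV e) mem_imset // !(inj_eq f_inj).
exact/IH/embeds_contract.
Qed.

End TrigraphEmbedding.

Lemma has_dseq_red_deg (T : finType) d (H : trigraph T) : has_dseq d H -> red_deg_le d H.
Proof. by case. Qed.

(** * Edges of a contracted trigraph *)

Section ContractEdges.
Variables (T : finType) (H : trigraph T) (u v z : T).
Let C := contract H u v z.

Lemma contract_black x y : x \in tV C -> y \in tV C -> tblack C x y =
  (x != y) && (if x == z then tblack H u y && tblack H v y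
    else if y == z then tblack H u x && tblack H v x else tblack H x y).
Proof.
by move=> xC yC; rewrite [LHS]/tblack xC yC; move: xC yC; rewrite /C /= => -> -> /=; case: (x != y).
Qed.

Lemma contract_red x y : x \in tV C -> y \in tV C -> tred C x y =
  (x != y) && (if x == z then (tadj H u y || tadj H v y) && ~~ (tblack H u y && tblack H v y)
    else if y == z then (tadj H u x || tadj H v x) && ~~ (tblack H u x && tblack H v x)
    else tred H x y).
Proof.
by move=> xC yC; rewrite [LHS]/tred xC yC; move: xC yC; rewrite /C /= => -> -> /=; case: (x != y).
Qed.

Lemma contract_vertex x : x \in tV C -> x != z -> x \in tV H.
Proof. by rewrite /= !inE => /orP[->//|/and3P[]]. Qed.

End ContractEdges.

(** * Substituting trigraphs for the vertices of a graph *)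

Section LexicographicSubstitution.
Variables (d : nat) (T1 T2 : finType) (adj : rel T1).
Hypothesis adj_sym : symmetric adj.
Implicit Type K : T1 -> trigraph T2.

(** [K] varies with the vertex so as to cover every stage of the sequence, when the copies have been
    contracted to different extents; G[G] is the case of constant [K]. *)
Definition lexsub K : trigraph (T1 * T2)%type :=
  Trigraph [set p : T1 * T2 | p.2 \in tV (K p.1)]
    (fun p q => if p.1 == q.1 then tblack (K p.1) p.2 q.2 else adj p.1 q.1)
    (fun p q => (p.1 == q.1) && tred (K p.1) p.2 q.2).

Lemma lexsub_black K a x b y : tblack (lexsub K) (a, x) (b, y) =
  if a == b then tblack (K a) x y else [&& x \in tV (K a), y \in tV (K b) & adj a b].
Proof.
rewrite /tblack /= !inE /= -pair_eqE /=; case: eqP => [->|] //=; rewrite /tblack.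
by do 2!case: (_ \in _) => //=; case: (_ == _).
Qed.

Lemma lexsub_red K a x b y : tred (lexsub K) (a, x) (b, y) = (a == b) && tred (K a) x y.
Proof.
rewrite /tred /= !inE /= -pair_eqE /=; case: eqP => [->|] //=; last by rewrite !andbF.
rewrite /tred; by do 2!case: (_ \in _) => //=; case: (_ == _).
Qed.

Lemma lexsub_red_deg K : (forall a, red_deg_le d (K a)) -> red_deg_le d (lexsub K).
Proof.
move=> rd; apply/forall_inP => -[a x] /[!inE] /= xK.
have /forall_inP/(_ x xK) := rd a; apply: leq_trans.
have pI : injective (pair a : T2 -> _) by move=> ? ? [].
rewrite -(card_imset _ pI); apply: subset_leq_card.
apply/subsetP => -[b y] /[!inE] /= /andP[yK]; rewrite lexsub_red => /andP[/eqP e r].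
apply/imsetP; exists y; last by rewrite e.
by rewrite inE r andbT e.
Qed.

Definition replace K a H : T1 -> trigraph T2 := fun b => if b == a then H else K b.

(** A vertex of another copy is joined by black edges to both [u] and [v] or to neither, so its edge
    to [z] is black or absent, and red edges stay inside copy [a]. *)
Lemma lexsub_contract K a u v z : u \in tV (K a) -> v \in tV (K a) -> u != v ->
  embeds (fun p => p) (lexsub (replace K a (contract (K a) u v z)))
    (contract (lexsub K) (a, u) (a, v) (a, z)).
Proof.
move=> uK vK uv; set K' := replace _ _ _; set C := contract (lexsub K) _ _ _.
have VE b x : ((b, x) \in tV C) = (x \in tV (K' b)).
  rewrite /C /= !inE /= /K' /replace -!pair_eqE /=.
  by case: eqP => [->|_] //=; rewrite !inE.
split.
- by rewrite imset_id; apply/setP => -[b x]; rewrite VE inE.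
- move=> [b x] [c y] /[!inE] /= xK yK.
  rewrite contract_black ?VE // !lexsub_black -!pair_eqE /= xK yK uK vK /=.
  move: xK yK; rewrite /K' /replace.
  have [eb|ba] := eqVneq b a; have [ec|ca] := eqVneq c a => /= xK yK; try subst b; try subst c.
  + by rewrite eqxx /= contract_black.
  + rewrite (eq_sym a c) (negbTE ca) yK /=; case: eqP => [_|/eqP xz]; first by rewrite andbb.
    by rewrite (contract_vertex xK xz).
  + rewrite (negbTE ba) xK /=.
    case: eqP => [_|/eqP yz]; first by rewrite andbb adj_sym.
    by rewrite (contract_vertex yK yz).
  rewrite xK yK; case: eqP => //= _; rewrite /tblack.
  by case: (x \in _); case: (y \in _); case: (x == y).
- move=> [b x] [c y] /[!inE] /= xK yK.
  rewrite contract_red ?VE // !tadjE !lexsub_black !lexsub_red -!pair_eqE /= uK vK /=.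
  move: xK yK; rewrite /K' /replace.
  have [eb|ba] := eqVneq b a; have [ec|ca] := eqVneq c a => /= xK yK; try subst b; try subst c.
  + by rewrite eqxx /= contract_red // !tadjE.
  + rewrite (eq_sym a c) (negbTE ca) yK /= !orbF; case: eqP => [_|/eqP xz] //.
    by case: (adj a c).
  + rewrite (negbTE ba) xK /= !orbF.
    by case: eqP => [_|/eqP yz] //; case: (adj a b).
  case: eqP => //= _; rewrite /tred.
  by case: (x \in _); case: (y \in _); case: (x == y).
Qed.

(** The label of the vertex that remains in copy [a] depends on the derivation, so the result is
    handed to the premise [next] instead of being named. The equation [K a = H] lets the induction
    run along the sequence of [H] while [K] changes with it. *)
Lemma lexsub_dseq_at a H : has_dseq d H -> forall K, K a = H ->
  (forall b, red_deg_le d (K b)) ->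
  (forall K', (forall b, b != a -> K' b = K b) -> #|tV (K' a)| = 1 ->
     red_deg_le d (K' a) -> has_dseq d (lexsub K')) ->
  has_dseq d (lexsub K).
Proof.
elim=> {H} [H cH rd|H u v z rd uH vH uv zH h IH] K Ka rK next.
  by apply: next => //; rewrite Ka.
subst H; pose K' := replace K a (contract (K a) u v z).
have K'a : K' a = contract (K a) u v z by rewrite /K' /replace eqxx.
have K'b b : b != a -> K' b = K b by rewrite /K' /replace => /negbTE->.
apply: (dseq_step (u := (a, u)) (v := (a, v)) (z := (a, z))).
- exact: lexsub_red_deg.
- by rewrite inE.
- by rewrite inE.
- by rewrite -pair_eqE /= eqxx.
- by move: zH; rewrite !inE -!pair_eqE /= eqxx.
apply: embeds_dseq (lexsub_contract z uH vH uv) _ => //.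
apply: (IH K') => // [b|K2 K2b c2 rd2].
  by case: (eqVneq b a) => [->|/K'b->//]; rewrite K'a; exact: has_dseq_red_deg h.
by apply: next => // b ba; rewrite K2b // K'b.
Qed.

(** Shrinks the copies listed in [s] one after another; those outside [s] are single vertices
    already. *)
Lemma lexsub_dseq (s : seq T1) K :
  (forall b, red_deg_le d (K b)) -> (forall b, b \in s -> has_dseq d (K b)) ->
  (forall b, b \notin s -> #|tV (K b)| = 1) ->
  (forall K', (forall b, #|tV (K' b)| = 1) -> has_dseq d (lexsub K')) ->
  has_dseq d (lexsub K).
Proof.
elim: s K => [|a s IH] K rK dK cK next; first by apply: next => b; exact: cK.
apply: (lexsub_dseq_at (a := a) (dK a (mem_head _ _))) => // K' K'b c' r'.
apply: IH next => [b|b bs|b bs]; case: (eqVneq b a) => [->//|ba].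
- by rewrite K'b.
- exact: dseq_end.
- by rewrite K'b //; apply: dK; rewrite inE bs orbT.
- by rewrite K'b //; apply: cK; rewrite inE (negbTE ba).
Qed.

End LexicographicSubstitution.

(** * The lexicographic square: twin-width and independent sets *)

Section LexicographicSquare.
Variables (n : nat) (adj : rel 'I_n).
Hypothesis graph_adj : is_graph adj.

Lemma pair_ord_subproof (a b : 'I_n) : a * n + b < n * n.
Proof.
apply: (@leq_trans (a.+1 * n)); first by rewrite mulSn addnC ltn_add2r.
by rewrite leq_mul2r ltn_ord orbT.
Qed.
(** With (a, b) numbered [a * n + b], a bit string for a set of vertices of G[G] splits into rows of
    length [n], row [a] being the fiber over [a]. *)
Definition pair_ord a b : 'I_(n * n) := Ordinal (pair_ord_subproof a b).

Lemma square_gt0 (i : 'I_(n * n)) : 0 < n.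
Proof. by case: (n) i => [|//] [i]; rewrite muln0. Qed.

Lemma fst_ord_subproof (i : 'I_(n * n)) : i %/ n < n.
Proof. by rewrite ltn_divLR ?(square_gt0 i). Qed.
Definition fst_ord i : 'I_n := Ordinal (fst_ord_subproof i).

Lemma snd_ord_subproof (i : 'I_(n * n)) : i %% n < n.
Proof. by rewrite ltn_mod (square_gt0 i). Qed.
Definition snd_ord i : 'I_n := Ordinal (snd_ord_subproof i).

Lemma fst_pair_ord a b : fst_ord (pair_ord a b) = a.
Proof.
by apply: val_inj; rewrite /= divnMDl ?(square_gt0 (pair_ord a b)) // divn_small // addn0.
Qed.

Lemma snd_pair_ord a b : snd_ord (pair_ord a b) = b.
Proof. by apply: val_inj; rewrite /= modnMDl modn_small. Qed.

Lemma pair_ordK i : pair_ord (fst_ord i) (snd_ord i) = i.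
Proof. by apply: val_inj; rewrite /= -divn_eq. Qed.

Lemma pair_ord_inj : injective (fun p : 'I_n * 'I_n => pair_ord p.1 p.2).
Proof.
move=> [a b] [a' b'] /= e; have := congr1 fst_ord e; have := congr1 snd_ord e.
by rewrite !fst_pair_ord !snd_pair_ord => -> ->.
Qed.

Lemma pair_ord_eq a b a' b' : (pair_ord a b == pair_ord a' b') = (a == a') && (b == b').
Proof. exact: (inj_eq pair_ord_inj (a, b) (a', b')). Qed.

Definition lex_adj : rel 'I_(n * n) := fun i j =>
  adj (fst_ord i) (fst_ord j) || (fst_ord i == fst_ord j) && adj (snd_ord i) (snd_ord j).

Lemma lex_graph : is_graph lex_adj.
Proof.
case: graph_adj => sy ir; split=> [i j|i]; rewrite /lex_adj.
  by rewrite (sy (fst_ord i)) (sy (snd_ord i)) eq_sym.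
by rewrite !ir andbF.
Qed.

Lemma lex_tww d : tww_le adj d -> tww_le lex_adj d.
Proof.
move=> dG; have [sy ir] := graph_adj.
pose K (a : 'I_n) := graph_trigraph adj.
apply: (embeds_dseq pair_ord_inj (H := lexsub adj K)).
  split.
  - apply/setP => i; rewrite inE; apply/esym/imsetP; exists (fst_ord i, snd_ord i).
      by rewrite !inE.
    by rewrite /= pair_ordK.
  - move=> [a b] [a' b'] _ _; rewrite lexsub_black /tblack /= !inE /= /lex_adj.
    rewrite !fst_pair_ord !snd_pair_ord pair_ord_eq.
    case: eqP => [->|] //=; last by rewrite orbF.
    by rewrite ir.
  - by move=> [a b] [a' b'] _ _; rewrite lexsub_red /tred /= !andbF.
apply: (lexsub_dseq sy (s := enum 'I_n)) => [b|b _|b|K' c'].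
- exact: has_dseq_red_deg dG.
- exact: dG.
- by rewrite mem_enum.
(* Each copy is now a single vertex, with label [x a]. The map sending [a] to [(a, x a)] identifies
   what is left with the original graph, whose own [d]-sequence completes the contraction. *)
have ex a : exists x, tV (K' a) == [set x].
  by have /eqP/cards1P[x ->] := c' a; exists x.
pose x a := xchoose (ex a); have xE a : tV (K' a) = [set x a] by exact/eqP/(xchooseP (ex a)).
apply: (embeds_dseq (f := fun a => (a, x a))) dG => [a b [] //|].
split.
- apply/setP => -[a y]; rewrite !inE /= xE inE; apply/eqP/imsetP => [->|[b _ [-> ->//]]].
  by exists a; rewrite ?inE.
- move=> a b _ _; rewrite lexsub_black /tblack /= !inE !xE !set11 /=.
  by case: eqP => [->|_] /=; rewrite ?eqxx /= ?andbF.
- move=> a b _ _; rewrite lexsub_red /tred /= !andbF.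
  by case: eqP => [->|//]; rewrite eqxx !andbF.
Qed.

Lemma independentP m (e : rel 'I_m) (S : {set 'I_m}) :
  reflect {in S &, forall x y, ~~ e x y} (independent e S).
Proof.
apply: (iffP forall_inP) => [h x y xS yS|h x xS]; first exact: (forall_inP (h x xS)).
by apply/forall_inP => y; exact: h.
Qed.

Lemma alpha_max m (e : rel 'I_m) (S : {set 'I_m}) : independent e S -> #|S| <= alpha e.
Proof. by move=> iS; apply: (@leq_bigmax_cond _ (independent e) (fun S : {set 'I_m} => #|S|)). Qed.

Lemma alpha_witness m (e : rel 'I_m) : exists2 S, independent e S & #|S| = alpha e.
Proof.
have i0 : independent e set0 by apply/independentP => x y; rewrite inE.
have [S iS eS] := @eq_bigmax_cond _ (independent e) (fun S : {set 'I_m} => #|S|)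
  (ltac:(by apply/card_gt0P; exists set0)).
by exists S.
Qed.

(** The product of a maximum independent set with itself is independent in G[G]. *)
Lemma alpha_lex : alpha adj * alpha adj <= alpha lex_adj.
Proof.
have [S /independentP iS <-] := alpha_witness adj.
pose SS := [set i | (fst_ord i \in S) && (snd_ord i \in S)].
have -> : #|S| * #|S| = #|SS|.
  rewrite -cardsX -(card_imset _ pair_ord_inj); apply: eq_card => i; rewrite inE.
  apply/imsetP/andP => [[[a b]] /setXP[aS bS] ->|[iS1 iS2]].
    by rewrite fst_pair_ord snd_pair_ord.
  by exists (fst_ord i, snd_ord i); rewrite ?inE /= ?iS1 ?iS2 ?pair_ordK.
apply: alpha_max; apply/independentP => i j /[!inE] /andP[i1 i2] /andP[j1 j2].
by rewrite /lex_adj negb_or negb_and !iS // orbT.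
Qed.

Variable S : {set 'I_(n * n)}.
Definition fiber (a : 'I_n) : {set 'I_n} := [set b | pair_ord a b \in S].
Definition shadow : {set 'I_n} := [set a | fiber a != set0].

Lemma fiber_independent a : independent lex_adj S -> independent adj (fiber a).
Proof.
move=> /independentP iS; apply/independentP => b c /[!inE] bS cS.
have := iS _ _ bS cS; rewrite /lex_adj !fst_pair_ord !snd_pair_ord eqxx /= negb_or.
by case/andP.
Qed.

Lemma shadow_independent : independent lex_adj S -> independent adj shadow.
Proof.
move=> /independentP iS; apply/independentP => a b.
rewrite !inE => /set0Pn[c /[!inE] cS] /set0Pn[e /[!inE] eS].
by have := iS _ _ cS eS; rewrite /lex_adj !fst_pair_ord negb_or => /andP[].
Qed.

Lemma card_fibers m : #|shadow| <= m -> (forall a, #|fiber a| <= m) -> #|S| <= m * m.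
Proof.
move=> sm fm; rewrite -sum1_card (partition_big fst_ord (mem shadow)) /=; last first.
  by move=> i iS; rewrite !inE; apply/set0Pn; exists (snd_ord i); rewrite inE pair_ordK.
apply: leq_trans (_ : \sum_(a in shadow) m <= _); last first.
  by rewrite sum_nat_const leq_mul2r sm orbT.
apply: leq_sum => a _; apply: leq_trans (fm a).
rewrite sum1_card -(card_imset (mem (fiber a)) (f := pair_ord a)); last first.
  by move=> b c /(congr1 snd_ord); rewrite !snd_pair_ord.
apply: subset_leq_card; apply/subsetP => i /andP[iS /eqP <-].
by apply/imsetP; exists (snd_ord i); rewrite ?inE pair_ordK.
Qed.

End LexicographicSquare.

(** * Machines on a one-sided tape and their composition *)

Record machine (A : Type) := Machine {
  mst : finType;
  mstart : mst;
  mdelta : mst -> A -> option (mst * A * bool) }.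

Section Machines.
Variable A : Type.
Implicit Types (M : machine A) (g : nat -> A) (a : A).

Definition write g p a : nat -> A := fun j => if j == p then a else g j.

Lemma write_id g p : write g p (g p) = g.
Proof. by apply: functional_extensionality => j; rewrite /write; case: eqP => [->|]. Qed.

(** The tape is a function of the cell number, and no rule moves left from cell 0: a derivation also
    certifies that the head never passes the left end. *)
Inductive reach M : nat -> mst M -> nat -> (nat -> A) ->
    mst M -> nat -> (nat -> A) -> Prop :=
  | reach0 q p g : reach 0 q p g q p g
  | reachR q p g q1 a t q2 p2 g2 :
      mdelta q (g p) = Some (q1, a, true) ->
      reach t q1 p.+1 (write g p a) q2 p2 g2 -> reach t.+1 q p g q2 p2 g2
  | reachL q p g q1 a t q2 p2 g2 :
      mdelta q (g p.+1) = Some (q1, a, false) ->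
      reach t q1 p (write g p.+1 a) q2 p2 g2 -> reach t.+1 q p.+1 g q2 p2 g2.

Definition exec_from M t (q : mst M) p g p' g' :=
  exists2 q', reach t q p g q' p' g' & mdelta q' (g' p') = None.

Definition exec M t p g p' g' := exec_from t (mstart M) p g p' g'.

Lemma reach_cat M t1 t2 (q1 q2 q3 : mst M) p1 p2 p3 g1 g2 g3 :
  reach t1 q1 p1 g1 q2 p2 g2 -> reach t2 q2 p2 g2 q3 p3 g3 ->
  reach (t1 + t2) q1 p1 g1 q3 p3 g3.
Proof.
elim=> {t1 q1 p1 g1 q2 p2 g2} [//|q p g q1 a t q2 p2 g2 e r IH /IH|q p g q1 a t q2 p2 g2 e r IH /IH] r'.
  exact: reachR e r'.
exact: reachL e r'.
Qed.

(** Only the first transition depends on the starting state, so states that agree on the symbol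
    under the head have the same runs. An empty run keeps its own state, which is why the conclusion
    compares transitions and not states. *)
Lemma reach_same M t (q1 q2 q' : mst M) p g p' g' :
  mdelta q1 (g p) = mdelta q2 (g p) -> reach t q1 p g q' p' g' ->
  exists2 q'', reach t q2 p g q'' p' g' & mdelta q'' (g' p') = mdelta q' (g' p').
Proof.
move=> e r; case: r e => {t q1 p g q' p' g'} [q p g|q p g q1 a t q3 p2 g2 d r|q p g q1 a t q3 p2 g2 d r] e.
- by exists q2; [exact: reach0 | rewrite e].
- by exists q3 => //; apply: reachR r; rewrite -e d.
- by exists q3 => //; apply: reachL r; rewrite -e d.
Qed.

(** Gluing rule for all composites: the state in which the first run ends need only act like the
    next starting state on the current symbol. *)
Lemma reach_exec M t1 t2 (q1 q2 q3 : mst M) p1 p2 p3 g1 g2 g3 :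
  reach t1 q1 p1 g1 q2 p2 g2 -> mdelta q2 (g2 p2) = mdelta q3 (g2 p2) ->
  exec_from t2 q3 p2 g2 p3 g3 -> exec_from (t1 + t2) q1 p1 g1 p3 g3.
Proof.
move=> r1 e [q' r2 h]; case: (reach_same (esym e) r2) => q'' r3 h3.
by exists q''; [exact: reach_cat r1 r3 | rewrite h3].
Qed.

Lemma reach_embed M M' (f : mst M -> mst M') t q p g q' p' g' :
  (forall q a q1 a1 m, mdelta q a = Some (q1, a1, m) ->
     mdelta (f q) a = Some (f q1, a1, m)) ->
  reach t q p g q' p' g' -> reach t (f q) p g (f q') p' g'.
Proof.
move=> H; elim=> {t q p g q' p' g'} [q p g|q p g q1 a t q2 p2 g2 /H e r IH|q p g q1 a t q2 p2 g2 /H e r IH].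
- exact: reach0.
- exact: reachR e IH.
- exact: reachL e IH.
Qed.

Definition mlift (Q Q' : Type) (f : Q -> Q') (o : option (Q * A * bool)) :=
  if o is Some (q, a, m) then Some (f q, a, m) else None.

Definition mskip : machine A :=
  @Machine A unit tt (fun _ _ => None).

(** A separate transition for passing control would move the head; so where [M1] halts, the first
    transition of [M2] is taken at once. *)
Definition mseq M1 M2 : machine A :=
  @Machine A (mst M1 + mst M2)%type (inl (mstart M1))
    (fun q a => match q with
     | inl q1 => if mdelta q1 a is Some r then mlift inl (Some r)
                 else mlift inr (mdelta (mstart M2) a)
     | inr q2 => mlift inr (mdelta q2 a) end).

Definition mif (c : A -> bool) M1 M2 : machine A :=
  @Machine A (option (mst M1 + mst M2))%type None
    (fun q a => match q with
     | None => if c a then mlift (Some \o inl) (mdelta (mstart M1) a)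
               else mlift (Some \o inr) (mdelta (mstart M2) a)
     | Some (inl q1) => mlift (Some \o inl) (mdelta q1 a)
     | Some (inr q2) => mlift (Some \o inr) (mdelta q2 a) end).

Definition mwhile (c : A -> bool) M : machine A :=
  let entry a := if c a then mlift Some (mdelta (mstart M) a) else None in
  @Machine A (option (mst M)) None
    (fun q a => if q is Some q1 then
        if mdelta q1 a is Some r then mlift Some (Some r) else entry a
      else entry a).

Lemma exec_skip p g : exec mskip 0 p g p g.
Proof. by exists tt => //; exact: reach0. Qed.

Lemma exec_seq M1 M2 t1 t2 p1 p2 p3 g1 g2 g3 :
  exec M1 t1 p1 g1 p2 g2 -> exec M2 t2 p2 g2 p3 g3 ->
  exec (mseq M1 M2) (t1 + t2) p1 g1 p3 g3.
Proof.
move=> [q1 r1 h1] [q2 r2 h2].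
apply: (reach_exec (M := mseq M1 M2) (q2 := inl q1) (q3 := inr (mstart M2))).
- by apply: (reach_embed (M' := mseq M1 M2) (f := inl)) r1 => q a q' a1 m /= ->.
- by rewrite /= h1.
exists (inr q2); last by rewrite /= h2.
by apply: (reach_embed (M' := mseq M1 M2) (f := inr)) r2 => q a q' a1 m /= ->.
Qed.

Lemma exec_if (c : A -> bool) M1 M2 t p g p' g' :
  exec (if c (g p) then M1 else M2) t p g p' g' ->
  exec (mif c M1 M2) t p g p' g'.
Proof.
set M := mif _ _ _; case: ifP => cg [q r h].
  apply: (reach_exec (t1 := 0) (q3 := Some (inl (mstart M1)) : mst M) (reach0 _ _ _)).
    by rewrite /= cg.
  exists (Some (inl q)); last by rewrite /= h.
  by apply: (reach_embed (M' := M) (f := Some \o inl)) r => q0 a q1 a1 m /= ->.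
apply: (reach_exec (t1 := 0) (q3 := Some (inr (mstart M2)) : mst M) (reach0 _ _ _)).
  by rewrite /= cg.
exists (Some (inr q)); last by rewrite /= h.
by apply: (reach_embed (M' := M) (f := Some \o inr)) r => q0 a q1 a1 m /= ->.
Qed.

Lemma exec_while_false (c : A -> bool) M p g :
  ~~ c (g p) -> exec (mwhile c M) 0 p g p g.
Proof. by move=> /negbTE cg; exists None; [exact: reach0 | rewrite /= cg]. Qed.

Lemma exec_while_true (c : A -> bool) M t1 t2 p1 p2 p3 g1 g2 g3 :
  c (g1 p1) -> exec M t1 p1 g1 p2 g2 -> exec (mwhile c M) t2 p2 g2 p3 g3 ->
  exec (mwhile c M) (t1 + t2) p1 g1 p3 g3.
Proof.
(* A body that halts without a step leaves position and tape unchanged, so the run of the remaining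
   loop is the whole run. *)
move=> cg [q r h] X; case: t1 r => [|t1] r.
  by inversion r; subst.
have r' : reach t1.+1 (Some (mstart M) : mst (mwhile c M)) p1 g1 (Some q) p2 g2.
  by apply: (reach_embed (M' := mwhile c M) (f := Some)) r => q0 a q1 a1 m /= ->.
have e : mdelta (Some (mstart M) : mst (mwhile c M)) (g1 p1)
          = mdelta (None : mst (mwhile c M)) (g1 p1).
  by rewrite /= cg; case: (mdelta _ _).
have [q' r'' eq'] := reach_same e r'.
by apply: reach_exec r'' _ X; rewrite eq' /= h.
Qed.

Lemma reach_walkR M (q : mst M) (a b : nat) g : a <= b ->
  (forall j, a <= j < b -> mdelta q (g j) = Some (q, g j, true)) ->
  reach (b - a) q a g q b g.
Proof.
move=> ab; rewrite -(subnKC ab); move: (b - a) => k; rewrite addKn.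
elim: k a {ab b} => [|k IH] a H; first by rewrite addn0; exact: reach0.
apply: (reachR (q1 := q) (a := g a)); first by apply: H; lia.
rewrite write_id -addSnnS; apply: IH => j Hj; apply: H; lia.
Qed.

Lemma reach_walkL M (q : mst M) (b : nat) g :
  (forall j, 0 < j <= b -> mdelta q (g j) = Some (q, g j, false)) ->
  reach b q b g q 0 g.
Proof.
elim: b => [|b IH] H; first exact: reach0.
apply: (reachL (q1 := q) (a := g b.+1)); first by apply: H; lia.
by rewrite write_id; apply: IH => j Hj; apply: H; lia.
Qed.

End Machines.

(** * Stack programs and their compilation *)

Section StackPrograms.
Variables (K : nat) (Reg Sym : finType).

Inductive cmd :=
  | Skip
  | Push of 'I_K & (Reg -> Sym)
  | Pop of 'I_K & (Reg -> option Sym -> Reg)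
  | Seq of cmd & cmd
  | If of (Reg -> bool) & cmd & cmd
  | While of (Reg -> bool) & cmd.

Definition store := seq (seq Sym).
Notation stk s i := (nth [::] s i).

(* [eval c r s n r' s']: from register [r] and stacks [s] (top first), [c]
   performs at most [n] stack operations. *)
Inductive eval : cmd -> Reg -> store -> nat -> Reg -> store -> Prop :=
  | ESkip r s n : eval Skip r s n r s
  | EPush i f r s n : eval (Push i f) r s n.+1 r (set_nth [::] s i (f r :: stk s i))
  | EPop i f r s n :
      eval (Pop i f) r s n.+1 (f r (ohead (stk s i))) (set_nth [::] s i (behead (stk s i)))
  | ESeq c1 c2 r s n1 r1 s1 n2 r2 s2 n : eval c1 r s n1 r1 s1 -> eval c2 r1 s1 n2 r2 s2 ->
      n1 + n2 <= n -> eval (Seq c1 c2) r s n r2 s2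
  | EIf p c1 c2 r s n r' s' :
      eval (if p r then c1 else c2) r s n r' s' -> eval (If p c1 c2) r s n r' s'
  | EWhileF (p : Reg -> bool) c r s n : ~~ p r -> eval (While p c) r s n r s
  | EWhileT (p : Reg -> bool) c r s n1 r1 s1 n2 r2 s2 n : p r ->
      eval c r s n1 r1 s1 -> eval (While p c) r1 s1 n2 r2 s2 -> n1 + n2 <= n ->
      eval (While p c) r s n r2 s2.

Lemma eval_weaken c r s n r' s' m : eval c r s n r' s' -> n <= m -> eval c r s m r' s'.
Proof.
move=> H; elim: H m => {c r s n r' s'}.
- by move=> *; constructor.
- by move=> i f r s n [//|m] _; constructor.
- by move=> i f r s n [//|m] _; constructor.
- by move=> c1 c2 r s n1 r1 s1 n2 r2 s2 n H1 _ H2 _ le m nm; apply: ESeq H1 H2 (leq_trans le nm).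
- by move=> p c1 c2 r s n r' s' _ IH m nm; constructor; apply: IH.
- by move=> *; constructor.
- by move=> p c r s n1 r1 s1 n2 r2 s2 n pr H1 _ H2 _ le m nm; apply: EWhileT pr H1 H2 (leq_trans le nm).
Qed.

Lemma eval_height c r s n r' s' i :
  eval c r s n r' s' -> size (stk s' i) <= size (stk s i) + n.
Proof.
elim=> {c r s n r' s'}.
- by move=> *; rewrite leq_addr.
- by move=> j f r s n; rewrite nth_set_nth /=; case: eqP => [->|_] /=; lia.
- by move=> j f r s n; rewrite nth_set_nth /=; case: eqP => [->|_] /=; rewrite ?size_behead; lia.
- by move=> c1 c2 r s n1 r1 s1 n2 r2 s2 n _ IH1 _ IH2 le; lia.
- by [].
- by move=> *; rewrite leq_addr.
- by move=> p c r s n1 r1 s1 n2 r2 s2 n _ _ IH1 _ IH2 le; lia.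
Qed.

(* Tape layout: cell 0 holds the register, cell j+1 holds the j-th entry, from
   the bottom, of every stack. *)
Variable A : Type.
Notation cell := (Reg + {ffun 'I_K -> option Sym})%type.
Variables (dec : A -> cell) (enc : cell -> A).
Hypothesis encK : cancel enc dec.

(** Only [cancel enc dec] is assumed: several symbols may decode to the same cell. Blanks and raw
    input bits can thus count as cells, and an untouched input already represents a store. *)
Definition repr (r : Reg) (s : store) (g : nat -> A) :=
  dec (g 0) = inl r /\
  forall j, exists2 f, dec (g j.+1) = inr f &
    forall i : 'I_K, f i = onth (rev (stk s i)) j.

Definition put (f : {ffun 'I_K -> option Sym}) i x : {ffun 'I_K -> option Sym} :=
  [ffun j => if j == i then x else f j].

Inductive push_state := PushStart | PushRight of Sym | PushLeft.
Definition push_state_code q : option (option Sym) :=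
  match q with PushStart => None | PushRight x => Some (Some x) | PushLeft => Some None end.
Definition push_state_decode c :=
  match c with None => PushStart | Some (Some x) => PushRight x | Some None => PushLeft end.
Lemma push_state_codeK : cancel push_state_code push_state_decode.
Proof. by case. Qed.
HB.instance Definition _ := Finite.copy push_state (can_type push_state_codeK).

(** Decoding tells the home cell ([inl]) from the track cells ([inr]), so the way back needs no
    counter; the value to be pushed travels in the state. *)
Definition mpush i (f : Reg -> Sym) : machine A :=
  @Machine A push_state PushStart (fun q a =>
    match q, dec a with
    | PushStart, inl r => Some (PushRight (f r), a, true)
    | PushStart, inr _ => None
    | PushRight x, inr c =>
        if c i is Some _ then Some (PushRight x, a, true)
        else Some (PushLeft, enc (inr (put c i (Some x))), false)
    | PushRight _, inl _ => None
    | PushLeft, inr _ => Some (PushLeft, a, false)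
    | PushLeft, inl _ => None
    end).

Inductive pop_state := PopStart | PopRight of Reg | PopTop of Reg | PopLeft of Reg
  | PopBack | PopEnd.
Definition pop_state_code q : option (option (Reg + (Reg + (Reg + unit)))) :=
  match q with
  | PopStart => None | PopBack => Some None | PopRight x => Some (Some (inl x))
  | PopTop x => Some (Some (inr (inl x))) | PopLeft x => Some (Some (inr (inr (inl x))))
  | PopEnd => Some (Some (inr (inr (inr tt)))) end.
Definition pop_state_decode (c : option (option (Reg + (Reg + (Reg + unit))))) :=
  match c with
  | None => PopStart | Some None => PopBack | Some (Some (inl x)) => PopRight x
  | Some (Some (inr (inl x))) => PopTop x | Some (Some (inr (inr (inl x)))) => PopLeft x
  | Some (Some (inr (inr (inr tt)))) => PopEnd end.
Lemma pop_state_codeK : cancel pop_state_code pop_state_decode.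
Proof. by case. Qed.
HB.instance Definition _ := Finite.copy pop_state (can_type pop_state_codeK).

(** The head stops at the first free cell of the track and steps back; meeting the home cell there
    means that the stack is empty. Writing the new register moves the head off the home cell, and
    [PopBack] brings it back. *)
Definition mpop i (f : Reg -> option Sym -> Reg) : machine A :=
  @Machine A pop_state PopStart (fun q a =>
    match q, dec a with
    | PopStart, inl r => Some (PopRight r, a, true)
    | PopRight r, inr c =>
        if c i is Some _ then Some (PopRight r, a, true) else Some (PopTop r, a, false)
    | PopTop r, inl _ => Some (PopBack, enc (inl (f r None)), true)
    | PopTop r, inr c => Some (PopLeft (f r (c i)), enc (inr (put c i None)), false)
    | PopLeft r, inr _ => Some (PopLeft r, a, false)
    | PopLeft r, inl _ => Some (PopBack, enc (inl r), true)
    | PopBack, _ => Some (PopEnd, a, false)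
    | _, _ => None
    end).

Definition on_reg (p : Reg -> bool) a := if dec a is inl r then p r else false.

Fixpoint compile c : machine A :=
  match c with
  | Skip => mskip A
  | Push i f => mpush i f
  | Pop i f => mpop i f
  | Seq c1 c2 => mseq (compile c1) (compile c2)
  | If p c1 c2 => mif (on_reg p) (compile c1) (compile c2)
  | While p c => mwhile (on_reg p) (compile c)
  end.

Lemma onth_rev_cons (x : Sym) s j :
  onth (rev (x :: s)) j = if j == size s then Some x else onth (rev s) j.
Proof.
rewrite rev_cons !onthE map_rcons nth_rcons size_map size_rev.
by case: ltngtP => // h; rewrite nth_default // size_map size_rev ltnW.
Qed.

Lemma onth_rev_size (s : seq Sym) j : (onth (rev s) j == None) = (size s <= j).
Proof.
by rewrite -size_rev -onthNE; case: onth.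
Qed.

Lemma repr_some r s g (i : 'I_K) j : repr r s g -> j < size (stk s i) ->
  exists f x, dec (g j.+1) = inr f /\ f i = Some x.
Proof.
case=> _ /(_ j) [f e /(_ i) fi]; rewrite ltnNge -onth_rev_size -fi => h.
by exists f; case: (f i) h => // x _; exists x.
Qed.

Lemma exec_push i f r s g : repr r s g ->
  exists t g', [/\ exec (mpush i f) t 0 g 0 g',
    repr r (set_nth [::] s i (f r :: stk s i)) g' & t <= 2 * size (stk s i) + 8].
Proof.
move=> R; have [R0 RS] := R; set h := size (stk s i).
have [c dc cE] := RS h.
have ci : c i = None by rewrite cE; apply/eqP; rewrite onth_rev_size.
pose g' := write g h.+1 (enc (inr (put c i (Some (f r))))).
have w1 : reach (M := mpush i f) h (PushRight (f r)) 1 g (PushRight (f r)) h.+1 g.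
  have := @reach_walkR _ (mpush i f) (PushRight (f r)) 1 h.+1 g isT.
  rewrite subn1; apply=> -[//|j] /= jh.
  by have [c' [x [-> ->]]] := repr_some R (jh : j < size (stk s i)).
have w2 : reach (M := mpush i f) h PushLeft h g' PushLeft 0 g'.
  apply: reach_walkL => -[//|j] /= jh.
  have -> : g' j.+1 = g j.+1 by rewrite /g' /write; case: eqP => // -[]; lia.
  by have [c' ->] := RS j.
exists (h + h).+2, g'; split; last by rewrite -/h; lia.
- exists PushLeft; last by rewrite /= R0.
  apply: (reachR (M := mpush i f) (q1 := PushRight (f r)) (a := g 0)); first by rewrite /= R0.
  rewrite write_id -addnS; apply: reach_cat w1 _.
  by apply: (reachL (q1 := PushLeft) (M := mpush i f)) w2; rewrite /= dc ci.
split; first by rewrite /g' /write.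
move=> j; rewrite /g' /write eqSS; case: eqP => [->|jh].
  rewrite encK; exists (put c i (Some (f r))) => // k.
  rewrite ffunE nth_set_nth /= val_eqE; case: eqP => [_|_] //.
  by rewrite onth_rev_cons eqxx.
have [c' dc' c'E] := RS j; exists c' => // k.
rewrite nth_set_nth /= val_eqE; case: eqP => [->|_] //.
by rewrite onth_rev_cons c'E -/h; case: eqP.
Qed.

Lemma exec_pop i f r s g : repr r s g ->
  exists t g', [/\ exec (mpop i f) t 0 g 0 g',
    repr (f r (ohead (stk s i))) (set_nth [::] s i (behead (stk s i))) g'
    & t <= 2 * size (stk s i) + 8].
Proof.
move=> R; have [R0 RS] := R; set h := size (stk s i).
have [c dc cE] := RS h.
have ci : c i = None by rewrite cE; apply/eqP; rewrite onth_rev_size.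
have w1 : reach (M := mpop i f) h (PopRight r) 1 g (PopRight r) h.+1 g.
  have := @reach_walkR _ (mpop i f) (PopRight r) 1 h.+1 g isT.
  rewrite subn1; apply=> -[//|j] /= jh.
  by have [c' [x [-> ->]]] := repr_some R (jh : j < size (stk s i)).
have w2 : reach (M := mpop i f) h.+2 PopStart 0 g (PopTop r) h g.
  apply: (reachR (M := mpop i f) (q1 := PopRight r) (a := g 0)); first by rewrite /= R0.
  rewrite write_id -addn1; apply: reach_cat w1 _.
  apply: (reachL (M := mpop i f) (q1 := PopTop r) (a := g h.+1)); first by rewrite /= dc ci.
  by rewrite write_id; exact: reach0.
have fin r' g1 : (exists2 c', dec (g1 1) = inr c' & True) ->
    reach (M := mpop i f) 1 PopBack 1 (write g1 0 (enc (inl r')))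
      PopEnd 0 (write g1 0 (enc (inl r'))).
  move=> [c' e _]; apply: (reachL (M := mpop i f) (q1 := PopEnd) (a := g1 1)).
    by [].
  rewrite (_ : g1 1 = write g1 0 (enc (inl r')) 1) // write_id; exact: reach0.
case Es: (stk s i) => [|x l] /=.
  have h0 : h = 0 by rewrite /h Es.
  rewrite h0 in w2 *; exists 4, (write g 0 (enc (inl (f r None)))); split=> //.
    exists PopEnd => //; apply: (reach_cat (t1 := 2) (t2 := 2)) w2 _.
    apply: (reachR (M := mpop i f) (q1 := PopBack)); first by rewrite /= R0.
    by apply: fin; case: (RS 0) => c' ? _; exists c'.
  split; first by rewrite /write eqxx encK.
  move=> j; rewrite /write /=; have [c' ? c'E] := RS j; exists c' => // k.
  by rewrite nth_set_nth /= val_eqE c'E; case: eqP => // ->; rewrite Es.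
have hE : h = (size l).+1 by rewrite /h Es.
rewrite hE in w2 *; have [c1 d1 c1E] := RS (size l).
have c1i : c1 i = Some x by rewrite c1E Es onth_rev_cons eqxx.
pose g1 := write g (size l).+1 (enc (inr (put c1 i None))).
pose g' := write g1 0 (enc (inl (f r (Some x)))).
have g1S j : exists2 c', dec (g1 j.+1) = inr c' & True.
  rewrite /g1 /write; case: eqP => _; first by rewrite encK; eexists.
  by have [c' ? _] := RS j; exists c'.
have w3 : reach (M := mpop i f) (size l) (PopLeft (f r (Some x))) (size l) g1
     (PopLeft (f r (Some x))) 0 g1.
  by apply: reach_walkL => -[//|j] /= jh; have [c' -> _] := g1S j.
exists (h.+2 + (size l + 2).+1), g'; split; last by rewrite hE /=; lia.
  exists PopEnd => //; rewrite hE; apply: reach_cat w2 _.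
  apply: (reachL (M := mpop i f) (q1 := PopLeft (f r (Some x)))); first by rewrite /= d1 c1i.
  apply: reach_cat w3 _; apply: (reachR (M := mpop i f) (q1 := PopBack)).
    by rewrite /= /write /= R0.
  exact: fin.
split; first by rewrite /g' /write eqxx encK.
move=> j; rewrite /g' /g1 /write /= eqSS; case: eqP => [->|jl].
  rewrite encK; exists (put c1 i None) => // k.
  rewrite ffunE nth_set_nth /= val_eqE; case: eqP => [_|_] //.
  by apply/esym/eqP; rewrite onth_rev_size.
have [c' ? c'E] := RS j; exists c' => // k.
rewrite nth_set_nth /= val_eqE c'E; case: eqP => // ->.
by rewrite Es onth_rev_cons; case: eqP.
Qed.

(** [H] bounds all heights during the run: [n] operations raise a stack by at most [n], and
    [eval_height] restores the hypothesis for the later part. Each operation walks up a track and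
    back, in at most [2 * H + 8] steps. *)
Lemma exec_compile c r s n r' s' g H :
  eval c r s n r' s' -> repr r s g ->
  (forall i : 'I_K, size (stk s i) + n <= H) ->
  exists t g', [/\ exec (compile c) t 0 g 0 g', repr r' s' g' & t <= n * (2 * H + 8)].
Proof.
move=> E; elim: E g H => {c r s n r' s'} /=.
- by move=> r s n g H R _; exists 0, g; split=> //; exact: exec_skip.
- move=> i f r s n g H R hH.
  have [t [g' [e R' le]]] := exec_push i f R; exists t, g'; split=> //.
  by have := hH i; rewrite mulSn; lia.
- move=> i f r s n g H R hH.
  have [t [g' [e R' le]]] := exec_pop i f R; exists t, g'; split=> //.
  by have := hH i; rewrite mulSn; lia.
- move=> c1 c2 r s n1 r1 s1 n2 r2 s2 n E1 IH1 E2 IH2 le g H R hH.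
  have [i|t1 [g1 [e1 R1 le1]]] := IH1 g H R; first by have := hH i; lia.
  have [i|t2 [g2 [e2 R2 le2]]] := IH2 g1 H R1.
    by have := hH i; have := eval_height i E1; lia.
  exists (t1 + t2), g2; split=> //; first exact: exec_seq e1 e2.
  by apply: leq_trans (leq_add le1 le2) _; rewrite -mulnDl leq_mul2r le orbT.
- move=> p c1 c2 r s n r' s' E IH g H R hH.
  have [t [g1 [e R1 le]]] := IH g H R hH; exists t, g1; split=> //.
  by apply: exec_if; rewrite /on_reg; case: R => -> _; case: (p r) e.
- move=> p c r s n pr g H R hH; exists 0, g; split=> //.
  by apply: exec_while_false; rewrite /on_reg; case: R => ->.
- move=> p c r s n1 r1 s1 n2 r2 s2 n pr E1 IH1 E2 IH2 le g H R hH.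
  have [i|t1 [g1 [e1 R1 le1]]] := IH1 g H R; first by have := hH i; lia.
  have [i|t2 [g2 [e2 R2 le2]]] := IH2 g1 H R1.
    by have := hH i; have := eval_height i E1; lia.
  exists (t1 + t2), g2; split=> //.
    by apply: exec_while_true e1 e2; rewrite /on_reg; case: R => ->.
  by apply: leq_trans (leq_add le1 le2) _; rewrite -mulnDl leq_mul2r le orbT.
Qed.

End StackPrograms.

(** * From machines on numbered cells to Turing machines *)

Section ToTM.
Variables (m : nat) (M : machine 'I_m.+3).

(** The states of a [TM] are counted by a successor, which [#|mst M|] is not by conversion; one
    halting state is added, and [lift ord_max] skips it. *)
Definition tm_of : TM :=
  @MkTM #|mst M| m (lift ord_max (enum_rank (mstart M)))
    (fun i a => if unlift ord_max i is Some j then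
       mlift (fun q => lift ord_max (enum_rank q)) (mdelta (enum_val j) a) else None).

Definition stcode (q : mst M) : 'I_#|mst M|.+1 := lift ord_max (enum_rank q).

Lemma tm_of_delta q a : @tm_delta tm_of (stcode q) a = mlift stcode (mdelta q a).
Proof. by rewrite /= /stcode liftK enum_rankK. Qed.

(** The left part holds exactly the cells before [p]; the right part may end anywhere, the cells
    beyond its end being blank. *)
Definition tape_at (p : nat) (g : nat -> 'I_m.+3) (t : tape tm_of) :=
  [/\ tl t = rev (mkseq g p), thd t = g p &
      forall j, nth (blank tm_of) (tr t) j = g (p.+1 + j)].

Lemma mkseq_write (g : nat -> 'I_m.+3) p a : mkseq (write g p a) p = mkseq g p.
Proof.
apply/eq_in_map => j; rewrite mem_iota add0n => /andP[_ jp].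
by rewrite /write ltn_eqF.
Qed.

Lemma reach_run k (q q' : mst M) p p' g g' t : reach k q p g q' p' g' -> tape_at p g t ->
  exists2 t', run k ((stcode q, t) : config tm_of) = (stcode q', t') & tape_at p' g' t'.
Proof.
move=> r; elim: r t => {k q p g q' p' g'} [q p g t H|q p g q1 a k q2 p2 g2 e r IH|q p g q1 a k q2 p2 g2 e r IH].
- by exists t.
- case=> l x r0 [/= El Ex Er]; subst x.
  have H : tape_at p.+1 (write g p a) (@move tm_of true (Tape l a r0)).
    have W j : write g p a (p.+1 + j) = g (p.+1 + j) by rewrite /write; case: eqP => //; lia.
    have L : a :: l = rev (mkseq (write g p a) p.+1).
      by rewrite mkseqS rev_rcons mkseq_write {1}/write eqxx El.
    case: r0 Er => [|b r0] Er /=.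
      by split=> //= [|j]; [rewrite -[in RHS](addn0 p.+1) | rewrite addSnnS]; rewrite W -Er ?nth_nil.
    by split=> //= [|j]; [rewrite -[in RHS](addn0 p.+1) | rewrite addSnnS]; rewrite W -Er.
  have [t' rt' H'] := IH _ H; exists t' => //.
  by rewrite {1}/stcode liftK enum_rankK e.
case=> l x r0 [/= El Ex Er]; subst x.
have H : tape_at p (write g p.+1 a) (@move tm_of false (Tape l a r0)).
  rewrite El mkseqS rev_rcons /=; split=> /=.
  - congr rev; apply/eq_in_map => j; rewrite mem_iota add0n => /andP[_ jp].
    by rewrite /write ltn_eqF // ltnS ltnW.
  - by rewrite /write ltn_eqF.
  - case=> [|j] /=; first by rewrite addn0 /write eqxx.
    by rewrite Er addSnnS /write; case: eqP => //; lia.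
have [t' rt' H'] := IH _ H; exists t' => //.
by rewrite {1}/stcode liftK enum_rankK e.
Qed.

Lemma halted_tm_of (q : mst M) p g t : tape_at p g t -> mdelta q (g p) = None ->
  halted ((stcode q, t) : config tm_of).
Proof. by case: t => l x r [/= _ -> _] e; rewrite /halted /step tm_of_delta e. Qed.

End ToTM.

(** * Raw input and output of a compiled program *)

Section Compile.
Variables (K : nat) (Reg Sym : finType) (bit : bool -> Sym).
Hypothesis bit_inj : injective bit.
Notation cell := (Reg + {ffun 'I_K.+1 -> option Sym})%type.
Notation alphabet := ('I_#|{: cell}|.+3).
Notation stk s i := (nth [::] s i).

Definition raw (b : option bool) : alphabet :=
  inord (match b with None => 0 | Some false => 1 | Some true => 2 end).

(* The raw input symbols are read as cells holding one bit of stack 0. *)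
Definition dec_cell (a : alphabet) : cell :=
  match fintype.split (a : 'I_(3 + #|{: cell}|)) with
  | inl i => inr [ffun j => if j == ord0 then
       (if i == 0 :> nat then None else Some (bit (i == 2 :> nat))) else None]
  | inr k => enum_val k
  end.

(** The shift keeps encoded cells apart from the symbols blank, false and true. *)
Definition enc_cell (c : cell) : alphabet := rshift 3 (enum_rank c).

Lemma enc_cellK : cancel enc_cell dec_cell.
Proof.
move=> c; rewrite /dec_cell /enc_cell.
by rewrite (unsplitK (inr (enum_rank c) : 'I_3 + 'I_#|{: cell}|)) enum_rankK.
Qed.

Lemma dec_raw b : dec_cell (raw b) =
  inr [ffun j => if j == ord0 then omap bit b else None].
Proof.
pose k : 'I_3 := inord (match b with None => 0 | Some false => 1 | Some true => 2 end).
have -> : raw b = lshift #|{: cell}| k.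
  by apply: val_inj; rewrite /= /raw /k !inordK //; case: (b) => [[]|].
rewrite /dec_cell (unsplitK (inl k : 'I_3 + 'I_#|{: cell}|)) /k.
by congr inr; apply/ffunP => j; rewrite !ffunE inordK; case: (b) => [[]|].
Qed.

Notation mach := (machine alphabet).

Definition mhome (r : Reg) : mach :=
  @Machine alphabet (option bool) (Some true) (fun q a =>
    match q with
    | Some true => Some (Some false, enc_cell (inl r), true)
    | Some false => Some (None, a, false)
    | None => None end).

Lemma exec_home r g : exec (mhome r) 2 0 g 0 (write g 0 (enc_cell (inl r))).
Proof.
exists None => //; apply: (reachR (M := mhome r) (q1 := Some false)) => //.
apply: (reachL (M := mhome r) (q1 := None) (a := g 1)) => //.
rewrite (_ : g 1 = write g 0 (enc_cell (inl r)) 1) // write_id; exact: reach0.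
Qed.

(* Replaces the cells of stack 0 by raw bits and stops on the first of them. *)
Definition mfinal : mach :=
  @Machine alphabet (option (option bool)) None (fun q a =>
    match q, dec_cell a with
    | None, _ => Some (Some (Some true), a, true)
    | Some (Some true), inr c =>
        if c ord0 is Some x then Some (Some (Some true), raw (Some (x == bit true)), true)
        else Some (Some (Some false), raw None, false)
    | Some (Some false), inr _ => Some (Some (Some false), a, false)
    | Some (Some false), inl _ => Some (Some None, a, true)
    | _, _ => None
    end).

Lemma exec_final r s g y : repr dec_cell r s g -> stk s 0 = rev (map bit y) ->
  exists g', [/\ exec mfinal (2 * size y + 3) 0 g 1 g',
    forall j, j < size y -> g' j.+1 = raw (Some (nth false y j)) &
    g' (size y).+1 = raw None].
Proof.
case=> R0 RS sy.
(* The tape after [k] cells have been turned into raw bits. Stack 0 spells [y] from its bottom, so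
   the cell at height [k] yields bit [k]. *)
pose gk k := fun j => if 0 < j <= k then raw (Some (nth false y j.-1)) else g j.
have w1 k : k <= size y ->
    reach (M := mfinal) k (Some (Some true)) 1 g (Some (Some true)) k.+1 (gk k).
  elim: k => [|k IH] kh.
    rewrite (_ : gk 0 = g); first exact: reach0.
    by apply: functional_extensionality => j; rewrite /gk; case: j.
  rewrite -[X in reach X](addn1 k); apply: reach_cat (IH (ltnW kh)) _.
  have [c dc cE] := RS k.
  apply: (reachR (M := mfinal) (q1 := Some (Some true)) (a := raw (Some (nth false y k)))).
    rewrite /= /gk /= ltnn dc (cE ord0) /= sy revK onth_map.
    have := onthTE y k; rewrite kh; case e: (onth y k) => [x|] //= _.
    by rewrite (@onth_nth _ false _ _ _ e) (inj_eq bit_inj) eqb_id.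
  rewrite (_ : write _ _ _ = gk k.+1); first exact: reach0.
  apply: functional_extensionality => j; rewrite /write /gk; case: j => // j /=.
  by rewrite eqSS ltnS; case: ltngtP => // ->.
pose g' := write (gk (size y)) (size y).+1 (raw None).
have g'E j : exists c, dec_cell (g' j.+1) = inr c.
  rewrite /g' /write; case: eqP => _; first by rewrite dec_raw; eexists.
  rewrite /gk /=; case: ifP => _; first by rewrite dec_raw; eexists.
  by have [c e _] := RS j; exists c.
exists g'; split; last by rewrite /g' /write eqxx.
- exists (Some None) => //=.
  rewrite (_ : 2 * _ + 3 = (size y + (size y + 1).+1).+1); last by lia.
  apply: (reachR (M := mfinal) (q1 := Some (Some true)) (a := g 0)) => //.
  rewrite write_id; apply: reach_cat (w1 _ (leqnn _)) _.
  apply: (reachL (M := mfinal) (q1 := Some (Some false)) (a := raw None)).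
    have [c dc cE] := RS (size y).
    rewrite /= /gk /= ltnn dc cE /= sy revK.
    by rewrite onth_default // size_map.
  rewrite -/g'; apply: reach_cat.
    apply: (@reach_walkL _ mfinal (Some (Some false))) => -[//|j] _ /=.
    by have [c ->] := g'E j.
  apply: (reachR (M := mfinal) (q1 := Some None) (a := g' 0)).
    by rewrite /= /g' /write /= /gk /= R0.
  by rewrite write_id; exact: reach0.
move=> j jy; rewrite /g' /write eqSS ltn_eqF // /gk /=.
by rewrite jy.
Qed.

Definition mprogram (r0 : Reg) (c : cmd K.+1 Reg Sym) : mach :=
  mseq (mhome r0) (mseq (compile dec_cell enc_cell c) mfinal).

(* The tape head first steps left of the input to make room for the home cell. *)
Definition mstepleft (M : mach) : mach :=
  @Machine alphabet (option (mst M)) None (fun q a =>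
    if q is Some q1 then mlift Some (mdelta q1 a) else Some (Some (mstart M), a, false)).

Definition program_TM (r0 : Reg) (c : cmd K.+1 Reg Sym) : TM :=
  tm_of (mstepleft (mprogram r0 c)).

Lemma decode_prefix (r0 : Reg) c (s : seq (sym (program_TM r0 c))) (y : seq bool) :
  (forall j, j < size y -> nth (raw None) s j = raw (Some (nth false y j))) ->
  nth (raw None) s (size y) = raw None -> decode s = y.
Proof.
elim: y s => [|b y IH] [|a s] //= H H0.
- by rewrite H0 /raw inordK.
- by have := congr1 val (H 0 isT); rewrite /= !inordK //; case: (b).
have -> : a = raw (Some b) := H 0 isT.
have -> : decode s = y by apply: IH => // j jy; exact: (H j.+1).
by rewrite /raw inordK; case: (b).
Qed.

Lemma program_correct r0 c w n r' s' s y :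
  (forall i : 'I_K.+1, stk s i = if i == ord0 then rev (map bit w) else [::]) ->
  eval c r0 s n r' s' -> stk s' 0 = rev (map bit y) ->
  exists2 t, t <= n * (2 * (size w + n) + 8) + 2 * size y + 7 &
    halts_within (program_TM r0 c) w t y.
Proof.
move=> sE E s'E; set M := mstepleft (mprogram r0 c); pose T := tm_of M.
pose ws : seq (sym T) := map (fun b => raw (Some b)) w.
(* The tape after the step to the left: cell 0 is blank and the input starts at cell 1. *)
pose g0 : nat -> alphabet := fun j => if j is j'.+1 then nth (raw None) ws j' else raw None.
have I : init T w = (stcode (mstart M), @Tape T [::] (head (raw None) ws) (behead ws)).
  rewrite /init /=; case: w @ws {g0 sE} => [|b w] //=.
have S1 : step (init T w) =
    Some (stcode (Some (mstart (mprogram r0 c)) : mst M), @Tape T [::] (raw None)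
          (head (raw None) ws :: behead ws)).
  by rewrite I /= liftK enum_rankK.
have Z : tape_at 0 g0 (@Tape T [::] (raw None) (head (raw None) ws :: behead ws)).
  split=> //= j; case: (ws) j => [|x l] [|j] //=; exact: nth_nil.
(* Once the home cell is written, the input as it stands is stack 0 with its first bit at the
   bottom, and every other track decodes as empty. *)
have R : repr dec_cell r0 s (write g0 0 (enc_cell (inl r0))).
  split; first by rewrite /write eqxx enc_cellK.
  move=> j; rewrite /write /=.
  exists [ffun i : 'I_K.+1 => if i == ord0 then omap bit (onth w j) else None].
    rewrite -(dec_raw (onth w j)); congr dec_cell.
    have := onthTE w j; case e: (onth w j) => [b|] /= h.
      by rewrite (nth_map false) // (@onth_nth _ false _ _ _ e).
    by rewrite nth_default // size_map leqNgt -h.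
  move=> i; rewrite ffunE sE; case: eqP => _; last by rewrite onth0n.
  by rewrite revK onth_map.
have [i|t [g1 [e1 R1 le1]]] := exec_compile (@enc_cellK) (H := size w + n) E R.
  by rewrite sE; case: eqP => _; rewrite ?size_rev ?size_map //= leq_addl.
have [g2 [e2 y2 y2']] := exec_final R1 s'E.
have [q rq hq] := exec_seq (exec_home r0 g0) (exec_seq e1 e2).
have rq' := reach_embed (M := mprogram r0 c) (M' := M) (f := Some)
  (fun q a q1 a1 m e => congr1 (mlift Some) e) rq.
have [[l x r] rt [El Ex Er]] := reach_run rq' Z.
have rt' : run (2 + (t + (2 * size y + 3))).+1 (init T w) = (stcode (Some q : mst M), @Tape T l x r).
  by rewrite -rt /run S1.
exists (2 + (t + (2 * size y + 3))).+1; first by lia.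
split; rewrite rt'.
  by apply: (halted_tm_of (M := M)) (And3 El Ex Er) _;
    change (mlift (@Some (mst (mprogram r0 c))) (mdelta q (g2 1)) = None); rewrite hq.
apply: (@decode_prefix r0 c) => [[|j]|] /=.
- by move=> h; rewrite [x]Ex y2.
- by move=> h; rewrite [LHS]Er y2.
case: (size y) y2' {rt rt' y2 rq rq' e2} => [|k] E2; first by rewrite [x]Ex E2.
by rewrite [LHS]Er E2.
Qed.
End Compile.

(** * Loops, moves and unary counters *)

Lemma eval_seq K Reg Sym (c1 c2 : cmd K Reg Sym) r s n1 r1 s1 n2 r2 s2 :
  eval c1 r s n1 r1 s1 -> eval c2 r1 s1 n2 r2 s2 -> eval (Seq c1 c2) r s (n1 + n2) r2 s2.
Proof. by move=> h1 h2; apply: ESeq h1 h2 (leqnn _). Qed.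

Lemma eval_seq_inv K Reg Sym (c1 c2 : cmd K Reg Sym) r s n r2 s2 :
  eval (Seq c1 c2) r s n r2 s2 -> exists n1 r1 s1 n2,
  [/\ eval c1 r s n1 r1 s1, eval c2 r1 s1 n2 r2 s2 & n1 + n2 <= n].
Proof. by move=> h; inversion h; subst; do 4 eexists; split; eassumption. Qed.

Lemma eval_conv K Reg Sym (c : cmd K Reg Sym) r s n r1 s1 m r2 s2 :
  eval c r s n r1 s1 -> n <= m -> r1 = r2 -> s1 = s2 -> eval c r s m r2 s2.
Proof. by move=> h nm <- <-; exact: eval_weaken h nm. Qed.

Lemma behead_nseq (T : Type) n (x : T) : behead (nseq n x) = nseq n.-1 x.
Proof. by case: n. Qed.

Section Macros.
Variable M : TM.
Notation Sy := (sym M).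
Notation reg := ('I_(tm_k M).+1 * Sy * (bool * bool * bool * bool))%type.
Notation prog := (cmd 20 reg Sy).
Notation u := (blank M).
Notation upd s i l := (set_nth [::] s i l).
Notation stk s i := (nth [::] s i).

(* A register is (q, x, (b, e, a, g)): the state of M, the last symbol popped,
   the loop test, end of output, some bit of the row set, row larger than
   the best one. *)
Definition setb (r : reg) v : reg := let: (q, x, (b, e, a, g)) := r in (q, x, (v, e, a, g)).
Definition getb (r : reg) : bool := let: (q, x, (b, e, a, g)) := r in b.
Definition getx (r : reg) : Sy := let: (q, x, (b, e, a, g)) := r in x.
Definition setx (r : reg) v : reg := let: (q, x, (b, e, a, g)) := r in (q, v, (b, e, a, g)).

Definition PopX i : prog := Pop i (fun r o => setb (setx r (odflt u o)) o).
Definition Drop i : prog := Pop i (fun r _ => r).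
Definition PushX i : prog := Push i getx.
Definition Mark i : prog := Push i (fun _ => u).
Definition popb (r : reg) (o : option Sy) := setb r o.
Definition popx (r : reg) (o : option Sy) := setb (setx r (odflt u o)) o.

(* Pops stack i until it is found empty, running the body after each pop. *)
Definition Loop i f body : prog := Seq (Pop i f) (While getb (Seq body (Pop i f))).
Definition Clear i : prog := Loop i popb (Skip _ _ _).
Definition MoveMarks i j : prog := Loop i popb (Mark j).
Definition Move i j : prog := Loop i popx (PushX j).
(** Marks pass from [i] to [j], so during the body the two stacks show the rounds left and the
    rounds done, and inner loops can use both as bounds. The final move restores the counter. *)
Definition For i j body : prog := Seq (Loop i popb (Seq body (Mark j))) (MoveMarks j i).

Lemma setb_setb r v v' : setb (setb r v) v' = setb r v'.
Proof. by case: r => [[q x] [[[b e] a] g]]. Qed.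

Lemma getb_setb r v : getb (setb r v) = v.
Proof. by case: r => [[q x] [[[b e] a] g]]. Qed.

Lemma getx_setb r v : getx (setb r v) = getx r.
Proof. by case: r => [[q x] [[[b e] a] g]]. Qed.

Lemma getx_setx r v : getx (setx r v) = v.
Proof. by case: r => [[q x] [[[b e] a] g]]. Qed.

Lemma setx_setx r v v' : setx (setx r v) v' = setx r v'.
Proof. by case: r => [[q x] [[[b e] a] g]]. Qed.

Lemma setx_setb r v v' : setx (setb r v) v' = setb (setx r v') v.
Proof. by case: r => [[q x] [[[b e] a] g]]. Qed.

Lemma stk_upd (s : store Sy) (i j : 'I_20) l :
  stk (upd s i l) j = if j == i then l else stk s j.
Proof. by rewrite nth_set_nth /= val_eqE. Qed.

Lemma upd_id (s : store Sy) (i : 'I_20) l l' : upd (upd s i l) i l' = upd s i l'.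
Proof. by rewrite set_set_nth eqxx. Qed.

Lemma updC (s : store Sy) (i j : 'I_20) l l' :
  i != j -> upd (upd s i l) j l' = upd (upd s j l') i l.
Proof. by move=> ij; rewrite set_set_nth /= (negbTE (ij : (i : nat) != j)). Qed.

Lemma stk_upd2 (s : store Sy) (i j : 'I_20) l k : i != j -> stk (upd (upd s i l) j k) i = l.
Proof. by move=> ij; rewrite updC // stk_upd eqxx. Qed.

Lemma upd_upd2 (s : store Sy) (i j : 'I_20) l k l' : i != j ->
  upd (upd (upd s i l) j k) i l' = upd (upd s i l') j k.
Proof. by move=> ij; rewrite updC 1?eq_sym // upd_id. Qed.

Lemma eval_pop (i : 'I_20) f r s (l : seq Sy) : stk s i = l ->
  eval (Pop i f : prog) r s 1 (f r (ohead l)) (upd s i (behead l)).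
Proof. by move=> <-; exact: EPop. Qed.

Lemma eval_loop_nil (i : 'I_20) f body r (s : store Sy) : stk s i = [::] -> getb (f r None) = false ->
  eval (Loop i f body) r s 1 (f r None) (upd s i [::]).
Proof.
move=> e h; apply: (ESeq (n1 := 1) (n2 := 0)); [exact: eval_pop e| |by []].
by apply: EWhileF; rewrite h.
Qed.

Lemma eval_loop_cons (i : 'I_20) f body r (s : store Sy) x l n1 r1 s1 n2 r2 s2 :
  stk s i = x :: l -> getb (f r (Some x)) ->
  eval body (f r (Some x)) (upd s i l) n1 r1 s1 ->
  eval (Loop i f body) r1 s1 n2 r2 s2 -> eval (Loop i f body) r s (n1 + n2 + 1) r2 s2.
Proof.
move=> e h hb /eval_seq_inv[m1 [r3 [s3 [m2 [h1 h2 le]]]]].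
have hw := EWhileT (p := getb) h (eval_seq hb h1) h2 (leqnn _).
apply: ESeq (eval_pop _ _ e) hw _; lia.
Qed.

Lemma eval_clear (i : 'I_20) r (s : store Sy) l :
  eval (Clear i) r (upd s i l) (size l + 1) (setb r false) (upd s i [::]).
Proof.
elim: l r => [|x l IH] r.
  by rewrite -{2}(upd_id s i [::]); apply: eval_loop_nil; rewrite ?stk_upd ?eqxx ?getb_setb.
apply: eval_weaken; first apply: (eval_loop_cons (x := x) (l := l)).
- by rewrite stk_upd eqxx.
- by rewrite getb_setb.
- exact: (ESkip _ _ _ 0).
- by rewrite upd_id -(setb_setb r true); exact: IH.
by rewrite /=; lia.
Qed.

Lemma eval_move_marks (i j : 'I_20) r (s : store Sy) a b : i != j ->
  eval (MoveMarks i j) r (upd (upd s i (nseq a u)) j (nseq b u)) (2 * a + 1)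
    (setb r false) (upd (upd s i [::]) j (nseq (a + b) u)).
Proof.
move=> ij; elim: a b r => [|a IH] b r.
  have := eval_loop_nil (f := popb) (r := r) (Mark j) (stk_upd2 s [::] (nseq b u) ij).
  by rewrite /popb getb_setb upd_upd2 //; apply.
apply: eval_weaken; first apply: (eval_loop_cons (x := u) (l := nseq a u)).
- by rewrite stk_upd2.
- by rewrite getb_setb.
- exact: (EPush _ _ _ _ 0).
- rewrite (upd_upd2 _ _ _ _ ij) stk_upd eqxx upd_id.
  by rewrite -(setb_setb r true) addSnnS; exact: (IH b.+1).
by lia.
Qed.

Lemma eval_move (i j : 'I_20) r (s : store Sy) l k : i != j ->
  eval (Move i j) r (upd (upd s i l) j k) (2 * size l + 1)
    (setb (setx r u) false) (upd (upd s i [::]) j (rev l ++ k)).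
Proof.
move=> ij; elim: l k r => [|x l IH] k r.
  have := eval_loop_nil (f := popx) (r := r) (PushX j) (stk_upd2 s [::] k ij).
  by rewrite /popx getb_setb upd_upd2 //; apply.
apply: eval_weaken; first apply: (eval_loop_cons (x := x) (l := l)).
- by rewrite stk_upd2.
- by rewrite getb_setb.
- exact: (EPush _ _ _ _ 0).
- rewrite (upd_upd2 _ _ _ _ ij) stk_upd eqxx upd_id.
  rewrite (_ : setb (setx r u) false = setb (setx (popx r (Some x)) u) false); last first.
    by rewrite /popx setx_setb setx_setx setb_setb.
  by rewrite rev_cons cat_rcons /popx getx_setb getx_setx; exact: IH.
by rewrite /=; lia.
Qed.

(** Invariant rule: [R k] and [S k] are register and store after [k] rounds. Registers matter only
    up to the loop test, which the body may leave at any value [v]. A round costs [B + 4]: the body,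
    a pop, a mark, and two operations to move the mark back. *)
Lemma eval_for (i j : 'I_20) body n B (R : nat -> reg) (S : nat -> store Sy) r0 :
  i != j -> setb r0 true = setb (R 0) true ->
  (forall k, k < n -> exists v, eval body (setb (R k) true)
     (upd (upd (S k) i (nseq (n - k.+1) u)) j (nseq k u)) B (setb (R k.+1) v)
     (upd (upd (S k.+1) i (nseq (n - k.+1) u)) j (nseq k u))) ->
  eval (For i j body) r0 (upd (upd (S 0) i (nseq n u)) j [::]) (n * (B + 4) + 2)
    (setb (R n) false) (upd (upd (S n) i (nseq n u)) j [::]).
Proof.
move=> ij r0E H; pose n' := n.
have L k : k <= n -> forall r, setb r true = setb (R (n - k)) true ->
    eval (Loop i popb (Seq body (Mark j))) r
     (upd (upd (S (n - k)) i (nseq k u)) j (nseq (n - k) u)) (k * (B + 2) + 1)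
     (setb (R n) false) (upd (upd (S n) i [::]) j (nseq n u)).
  elim: k => [|k IH] kn r rE.
    rewrite subn0 in rE *; have -> : setb (R n) false = popb r None.
      by rewrite /popb -(setb_setb r true) rE setb_setb.
    have := eval_loop_nil (f := popb) (r := r) (Seq body (Mark j)) (stk_upd2 (S n) [::] (nseq n u) ij).
    by rewrite /popb getb_setb upd_upd2 //; apply.
  have [|v Hb] := H (n - k.+1); first by lia.
  rewrite (_ : (n - (n - k.+1).+1) = k) in Hb; last by lia.
  rewrite (_ : (n - k.+1).+1 = n - k) in Hb; last by lia.
  apply: eval_weaken; first apply: (eval_loop_cons (x := u) (l := nseq k u)).
  - by rewrite stk_upd2.
  - by rewrite getb_setb.
  - rewrite /popb (upd_upd2 _ _ _ _ ij) rE.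
    exact: eval_seq Hb (EPush _ _ _ _ 0).
  - rewrite stk_upd eqxx upd_id (_ : u :: _ = nseq (n - k) u); last first.
      by rewrite -(_ : (n - k.+1).+1 = n - k) //; lia.
    by apply: IH; [lia | rewrite setb_setb].
  by lia.
apply: eval_weaken; first apply: eval_seq.
- by have := L n (leqnn n) r0; rewrite subnn; apply.
- have ji : j != i by rewrite eq_sym.
  have := eval_move_marks (setb (R n) false) (S n) n 0 ji.
  by rewrite setb_setb addn0 !(updC _ _ _ ji); apply.
by lia.
Qed.

(** * Squaring the adjacency matrix *)

Notation eb := (enc_bit M).
Notation rs o := (rev (map eb o)).
Notation "# k" := (@Ordinal 20 k isT) (at level 1, format "# k").

Lemma eval_seq_pop (i : 'I_20) f (c : prog) r s n r' s' :
  eval c (f r (ohead (nth [::] s i))) (set_nth [::] s i (behead (nth [::] s i))) n r' s' ->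
  eval (Seq (Pop i f) c) r s (1 + n) r' s'.
Proof. by apply: eval_seq; exact: (EPop _ _ _ _ 0). Qed.

Lemma eval_seq_push (i : 'I_20) f (c : prog) r s n r' s' :
  eval c r (set_nth [::] s i (f r :: nth [::] s i)) n r' s' ->
  eval (Seq (Push i f) c) r s (1 + n) r' s'.
Proof. by apply: eval_seq; exact: (EPush _ _ _ _ 0). Qed.

(* Stack 19 stays empty: popping it only updates the register. *)
Definition SetReg f : prog := Pop #19 (fun r _ => f r).
Definition Norm : prog := SetReg (fun '(q, x, (b, e, a, g)) => (q, u, (false, e, a, g))).

(* i: input, then right half of the tape of M, then result; w, w2 and v, v2: two copies of
   the adjacency bits, each split at a reading position; n, xa, xb: loops over the vertices,
   with n2, a, b, t counting the iterations done; o: unary counter, then the bits of G[G];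
   l: left half of the tape of M; row, best: rows of its output; cb, cb2: unary size of best,
   already compared with row for the part in cb2; p: the copies met by the output. *)
Definition Stacks i w w2 v v2 n n2 xa a xb b t o l row best cb cb2 p : store Sy :=
  [:: i; w; w2; v; v2; n; n2; xa; a; xb; b; t; o; l; row; best; cb; cb2; p; [::]].

Definition load : prog := Loop #0 (popx) (Seq (PushX #1) (Seq (PushX #3) (Mark #12))).
(* Subtracts the odd numbers 1, 3, 5, and so on from the unary counter. *)
Definition isqrt : prog := Loop #12 (popb)
  (Seq (For #5 #6 (Seq (Drop #12) (Drop #12))) (Seq (Mark #5) (Seq (Mark #7) (Mark #9)))).
Definition transfer i j : prog := Seq (PopX i) (Seq (PushX j) Norm).
Definition block : prog :=
  Seq (PopX #1) (Seq (PushX #2) (Seq (For #5 #6 (PushX #12)) Norm)).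
Definition diagonal : prog := Seq (transfer #1 #2)
  (For #5 #6 (Seq (PopX #3) (Seq (PushX #4) (Seq (PushX #12) Norm)))).
(** Row (a, b) of the matrix of G[G]: block [c] repeats the entry (a, c) of G [n] times, except
    block [a], which is row [b] of G. Inside the loop over [a], stacks 8 and 7 hold [a] and
    [n - a - 1] marks and so drive the loops over the columns before and after [a]. *)
Definition matrix_row : prog := Seq (For #8 #11 block)
  (Seq diagonal (Seq (For #7 #11 block) (For #5 #6 (transfer #2 #1)))).
Definition square : prog := For #7 #8
  (Seq (For #9 #10 matrix_row) (Seq (For #5 #6 (transfer #1 #2)) (Move #4 #3))).

Section Generate.
Variables (q : 'I_(tm_k M).+1) (e a g : bool).
Variables (si sl srow sbest scb scb2 sp : seq Sy).
Notation rg b := (q, u, (b, e, a, g)).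

(** Popping reverses: the input stack has its last bit on top, so both copies end up with the first
    bit on top. *)
Lemma eval_load y v w o r : eval load r
  (Stacks (map eb y) w [::] v [::] [::] [::] [::] [::] [::] [::] [::] o sl srow sbest scb scb2 sp)
  (4 * size y + 1) (setb (setx r u) false)
  (Stacks [::] (rs y ++ w) [::] (rs y ++ v) [::] [::] [::] [::] [::] [::] [::] [::]
     (nseq (size y) u ++ o) sl srow sbest scb scb2 sp).
Proof.
elim: y v w o r => [|x y IH] v w o r.
  by apply: eval_loop_nil => //; rewrite /popx getb_setb.
apply: eval_weaken; first apply: (eval_loop_cons (x := eb x) (l := map eb y)) => //.
- by rewrite getb_setb.
- by do 2!apply: eval_seq_push; exact: (EPush _ _ _ _ 0).
- rewrite /popx getx_setb getx_setx /= rev_cons !cat_rcons.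
  rewrite (_ : setb (setx r u) false = setb (setx (popx r (Some (eb x))) u) false); last first.
    by rewrite /popx setx_setb setx_setx setb_setb.
  rewrite (_ : u :: nseq _ u ++ o = nseq (size y) u ++ u :: o); first exact: IH.
  by rewrite -[u :: o]/(nseq 1 u ++ o) catA -nseqD addn1.
by rewrite /=; lia.
Qed.

Variables (sw sv : seq Sy).

(** After [k] rounds [n * n - k * k] marks remain. A round removes [2 * k + 1] of them: one by the
    pop that tests the loop, the others by the inner loop over the [k] marks counted so far. *)
Lemma eval_isqrt n k m b : k + m = n -> eval isqrt (rg b)
  (Stacks si sw [::] sv [::] (nseq k u) [::] (nseq k u) [::] (nseq k u) [::] [::]
    (nseq (n * n - k * k) u) sl srow sbest scb scb2 sp)
  (m * (6 * n + 6) + 1) (rg false)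
  (Stacks si sw [::] sv [::] (nseq n u) [::] (nseq n u) [::] (nseq n u) [::] [::]
    [::] sl srow sbest scb scb2 sp).
Proof.
elim: m k b => [|m IH] k b kmn.
  by rewrite addn0 in kmn; subst k; rewrite subnn; exact: eval_loop_nil.
have kn : k < n by lia.
set J := n * n - k * k; have J0 : 0 < J by rewrite subn_gt0 ltn_mul.
have JE : n * n - k.+1 * k.+1 = J - 1 - 2 * k by rewrite /J mulSn mulnS; lia.
apply: eval_weaken; first apply: (eval_loop_cons (x := u) (l := nseq (J - 1) u)) => //.
- by rewrite /= -[RHS]/(nseq (J - 1).+1 u) subn1 prednK.
- apply: eval_seq; last by do 2!apply: eval_seq_push; exact: (EPush _ _ _ _ 0).
  have := @eval_for #5 #6 (Seq (Drop #12) (Drop #12)) k 2 (fun=> rg true)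
    (fun i => Stacks si sw [::] sv [::] (nseq k u) [::] (nseq k u) [::] (nseq k u) [::] [::]
      (nseq (J - 1 - 2 * i) u) sl srow sbest scb scb2 sp) (rg true) isT erefl.
  rewrite /= muln0 subn0; apply=> i ik; exists true.
  apply: eval_conv; first by apply: eval_seq_pop; exact: (EPop _ _ _ _ 0).
  - by [].
  - by [].
  by rewrite /= !behead_nseq (_ : (_ - 2 * i).-2 = J - 1 - 2 * i.+1) //; lia.
- by rewrite /= -JE; apply: (IH k.+1); lia.
by nia.
Qed.

Variable w : seq bool.

Lemma drop_bits p : p < size w ->
  map eb (drop p w) = eb (nth false w p) :: map eb (drop p.+1 w).
Proof. by move=> pw; rewrite (drop_nth false pw). Qed.

Lemma take_bits p : p < size w -> rs (take p.+1 w) = eb (nth false w p) :: rs (take p w).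
Proof. by move=> pw; rewrite (take_nth false pw) map_rcons rev_rcons. Qed.

Lemma eval_transfer_fwd p b v v2 k k2 xa al xb bl t o : p < size w ->
  eval (transfer #1 #2) (rg b)
   (Stacks si (map eb (drop p w)) (rs (take p w)) v v2 k k2 xa al xb bl t o sl srow sbest scb scb2 sp)
   3 (rg false)
   (Stacks si (map eb (drop p.+1 w)) (rs (take p.+1 w)) v v2 k k2 xa al xb bl t o
     sl srow sbest scb scb2 sp).
Proof.
move=> pw; apply: eval_conv; first by apply: eval_seq_pop; apply: eval_seq_push; exact: (EPop _ _ _ _ 0).
- by [].
- by [].
by rewrite /= (drop_bits pw) (take_bits pw).
Qed.

Lemma eval_transfer_bwd p b v v2 k k2 xa al xb bl t o : p < size w ->
  eval (transfer #2 #1) (rg b)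
   (Stacks si (map eb (drop p.+1 w)) (rs (take p.+1 w)) v v2 k k2 xa al xb bl t o
     sl srow sbest scb scb2 sp)
   3 (rg false)
   (Stacks si (map eb (drop p w)) (rs (take p w)) v v2 k k2 xa al xb bl t o
     sl srow sbest scb scb2 sp).
Proof.
move=> pw; apply: eval_conv; first by apply: eval_seq_pop; apply: eval_seq_push; exact: (EPop _ _ _ _ 0).
- by [].
- by [].
by rewrite /= (drop_bits pw) (take_bits pw).
Qed.

Lemma rs_rcons o x : rs (rcons o x) = eb x :: rs o.
Proof. by rewrite map_rcons rev_rcons. Qed.

Lemma nseq_rcons (T : Type) k (x : T) : nseq k.+1 x = rcons (nseq k x) x.
Proof. by rewrite -cats1 -[[:: x]]/(nseq 1 x) cat_nseq /ncons -iterD addnC. Qed.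

Variable n : nat.

Lemma eval_block p b v v2 xa al xb bl t o : p < size w ->
  eval block (rg b)
   (Stacks si (map eb (drop p w)) (rs (take p w)) v v2 (nseq n u) [::] xa al xb bl t (rs o)
     sl srow sbest scb scb2 sp)
   (5 * n + 5) (rg false)
   (Stacks si (map eb (drop p.+1 w)) (rs (take p.+1 w)) v v2 (nseq n u) [::] xa al xb bl t
     (rs (o ++ nseq n (nth false w p))) sl srow sbest scb scb2 sp).
Proof.
move=> pw; apply: eval_conv.
- apply: eval_seq_pop; apply: eval_seq_push; apply: eval_seq; last exact: (EPop _ _ _ _ 0).
  have := @eval_for #5 #6 (PushX #12) n 1 (fun=> (q, eb (nth false w p), (true, e, a, g)))
    (fun i => Stacks si (map eb (drop p.+1 w)) (rs (take p.+1 w)) v v2 (nseq n u) [::]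
      xa al xb bl t (rs (o ++ nseq i (nth false w p))) sl srow sbest scb scb2 sp)
    (q, eb (nth false w p), (true, e, a, g)) isT erefl.
  rewrite (drop_bits pw) /= cats0 take_bits //; apply=> i ik; exists true.
  rewrite -[_ :: nseq i _]/(nseq i.+1 (nth false w p)) nseq_rcons -rcons_cat rs_rcons.
  exact: (EPush _ _ _ _ 0).
- by lia.
- by [].
- by rewrite /= take_bits.
Qed.

(** One entry of the first copy is skipped, and [n] bits of the second copy are output in its
    place. *)
Lemma eval_diagonal p m b xa al xb bl t o : p < size w -> m + n <= size w ->
  eval diagonal (rg b)
   (Stacks si (map eb (drop p w)) (rs (take p w)) (map eb (drop m w)) (rs (take m w))
     (nseq n u) [::] xa al xb bl t (rs o) sl srow sbest scb scb2 sp)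
   (8 * n + 5) (rg false)
   (Stacks si (map eb (drop p.+1 w)) (rs (take p.+1 w)) (map eb (drop (m + n) w))
     (rs (take (m + n) w)) (nseq n u) [::] xa al xb bl t
     (rs (o ++ take n (drop m w))) sl srow sbest scb scb2 sp).
Proof.
move=> pw mw; apply: eval_conv; first apply: eval_seq.
- exact: eval_transfer_fwd.
- have := @eval_for #5 #6 (Seq (PopX #3) (Seq (PushX #4) (Seq (PushX #12) Norm))) n 4
    (fun=> rg true)
    (fun i => Stacks si (map eb (drop p.+1 w)) (rs (take p.+1 w)) (map eb (drop (m + i) w))
      (rs (take (m + i) w)) (nseq n u) [::] xa al xb bl t
      (rs (o ++ take i (drop m w))) sl srow sbest scb scb2 sp) (rg false) isT erefl.
  rewrite /= take0 cats0 addn0; apply=> i ik; exists false.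
  have iw : m + i < size w by lia.
  apply: eval_conv; first by apply: eval_seq_pop; do 2!apply: eval_seq_push; exact: (EPop _ _ _ _ 0).
  - by [].
  - by [].
  rewrite /= addnS (drop_bits iw) (take_bits iw) /= (take_nth false (s := drop m w)) ?size_drop; last by lia.
  by rewrite -rcons_cat rs_rcons nth_drop.
- by lia.
- by [].
- by [].
Qed.

Definition blocks a0 s k := flatten [seq nseq n (nth false w (a0 * n + c)) | c <- iota s k].
Definition lex_row a0 b0 := blocks a0 0 a0 ++ take n (drop (b0 * n) w) ++
  blocks a0 a0.+1 (n - a0.+1).

Lemma blocksS a0 s k : blocks a0 s k.+1 = blocks a0 s k ++ nseq n (nth false w (a0 * n + (s + k))).
Proof. by rewrite /blocks -addn1 iotaD map_cat flatten_cat /= cats0. Qed.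

Hypothesis size_w : size w = n * n.

Lemma index_lt a0 c : a0 < n -> c < n -> a0 * n + c < size w.
Proof.
rewrite size_w => an cn; have : a0.+1 * n <= n * n by rewrite leq_mul2r an orbT.
by rewrite mulSn; lia.
Qed.

(* [i] is the stack driving the loop over the columns s, ..., s + k - 1. *)
Lemma eval_blocks (i : 'I_20) a0 s k v v2 xa al xb bl o b : (i == #8) || (i == #7) ->
  a0 < n -> s + k <= n ->
  nth [::] (Stacks [::] [::] [::] [::] [::] [::] [::] xa al [::] [::] [::] [::] [::] [::] [::] [::] [::] [::]) i = nseq k u ->
  eval (For i #11 block) (rg b)
   (Stacks si (map eb (drop (a0 * n + s) w)) (rs (take (a0 * n + s) w)) v v2 (nseq n u) [::]
     xa al xb bl [::] (rs o) sl srow sbest scb scb2 sp)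
   (n * (5 * n + 9) + 2) (rg false)
   (Stacks si (map eb (drop (a0 * n + (s + k)) w)) (rs (take (a0 * n + (s + k)) w)) v v2
     (nseq n u) [::] xa al xb bl [::] (rs (o ++ blocks a0 s k)) sl srow sbest scb scb2 sp).
Proof.
move=> ii an skn ei; apply: (eval_weaken (n := k * (5 * n + 5 + 4) + 2)); last by nia.
have i11 : i != #11 by case/orP: ii => /eqP->.
have := @eval_for i #11 block k (5 * n + 5) (fun=> rg true)
  (fun j => Stacks si (map eb (drop (a0 * n + (s + j)) w)) (rs (take (a0 * n + (s + j)) w)) v v2
     (nseq n u) [::] xa al xb bl [::] (rs (o ++ blocks a0 s j)) sl srow sbest scb scb2 sp)
  (rg b) i11 erefl.
case/orP: ii ei => /eqP-> /= ei; subst; rewrite /= {1 2}addn0 {1}/blocks /= cats0; apply=> j jk.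
  exists false; rewrite blocksS catA (addnS s) (addnS (a0 * n)); apply: eval_block.
  by apply: index_lt => //; lia.
exists false; rewrite blocksS catA (addnS s) (addnS (a0 * n)); apply: eval_block.
by apply: index_lt => //; lia.
Qed.

Lemma eval_matrix_row a0 b0 xb bl o b : a0 < n -> b0 < n ->
  eval matrix_row (rg b)
   (Stacks si (map eb (drop (a0 * n) w)) (rs (take (a0 * n) w)) (map eb (drop (b0 * n) w))
     (rs (take (b0 * n) w)) (nseq n u) [::] (nseq (n - a0.+1) u) (nseq a0 u) xb bl [::] (rs o)
     sl srow sbest scb scb2 sp)
   (n * (10 * n + 33) + 11) (rg false)
   (Stacks si (map eb (drop (a0 * n) w)) (rs (take (a0 * n) w)) (map eb (drop (b0.+1 * n) w))
     (rs (take (b0.+1 * n) w)) (nseq n u) [::] (nseq (n - a0.+1) u) (nseq a0 u) xb bl [::]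
     (rs (o ++ lex_row a0 b0)) sl srow sbest scb scb2 sp).
Proof.
move=> an bn; apply: eval_conv.
- apply: eval_seq.
    have := @eval_blocks #8 a0 0 a0 (map eb (drop (b0 * n) w)) (rs (take (b0 * n) w))
      (nseq (n - a0.+1) u) (nseq a0 u) xb bl o b isT an (ltnW an) erefl.
    by rewrite addn0; apply.
  apply: eval_seq; first (apply: eval_diagonal; first exact: index_lt).
    by rewrite size_w; have : b0.+1 * n <= n * n; [rewrite leq_mul2r bn orbT | rewrite mulSn; lia].
  rewrite -[(a0 * n + (0 + a0)).+1]addnS; apply: eval_seq.
    have skn : a0.+1 + (n - a0.+1) <= n by lia.
    exact: (@eval_blocks #7 a0 a0.+1 (n - a0.+1) _ _ _ _ _ _ _ _ isT an skn erefl).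
  rewrite (_ : a0.+1 + _ = n); last by lia.
  (* Rewinds the first copy to the start of row [a0], which the next [b0] reads again. *)
  have := @eval_for #5 #6 (transfer #2 #1) n 3 (fun=> rg true)
    (fun i => Stacks si (map eb (drop (a0 * n + (n - i)) w)) (rs (take (a0 * n + (n - i)) w))
      (map eb (drop (b0 * n + n) w)) (rs (take (b0 * n + n) w)) (nseq n u) [::]
      (nseq (n - a0.+1) u) (nseq a0 u) xb bl [::]
      (rs (((o ++ blocks a0 0 a0) ++ take n (drop (b0 * n) w)) ++ blocks a0 a0.+1 (n - a0.+1)))
      sl srow sbest scb scb2 sp) (rg false) isT erefl.
  rewrite /= subn0; apply=> i ik; exists false.
  rewrite (_ : a0 * n + (n - i) = (a0 * n + (n - i.+1)).+1); last by lia.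
  by apply: eval_transfer_bwd; apply: index_lt => //; lia.
- by lia.
- by [].
by rewrite /= subnn addn0 -!catA -/(lex_row a0 b0) mulSn addnC.
Qed.

Definition lex_rows a0 k := flatten [seq lex_row a0 j | j <- iota 0 k].

Lemma lex_rowsS a0 k : lex_rows a0 k.+1 = lex_rows a0 k ++ lex_row a0 k.
Proof. by rewrite /lex_rows -addn1 iotaD map_cat flatten_cat /= cats0. Qed.

Definition lex_bits k := flatten [seq lex_rows i n | i <- iota 0 k].

Lemma lex_bitsS k : lex_bits k.+1 = lex_bits k ++ lex_rows k n.
Proof. by rewrite /lex_bits -addn1 iotaD map_cat flatten_cat /= cats0. Qed.

(** The cost [n * (B + 4) + 2] of [For], unfolded over the two outer loops; [7 * n] and
    [2 * (n * n)] come from advancing the first copy by a row and rewinding the second. *)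
Definition square_cost := n * (n * (n * (10 * n + 33) + 15) + 2 * (n * n) + 7 * n + 9) + 2.

Lemma eval_square b : eval square (rg b)
   (Stacks si (map eb w) [::] (map eb w) [::] (nseq n u) [::] (nseq n u) [::] (nseq n u) [::] [::]
     [::] sl srow sbest scb scb2 sp)
   square_cost (rg false)
   (Stacks si [::] (rs w) (map eb w) [::] (nseq n u) [::] (nseq n u) [::] (nseq n u) [::] [::]
     (rs (lex_bits n)) sl srow sbest scb scb2 sp).
Proof.
pose B := n * (n * (10 * n + 33) + 15) + 2 * (n * n) + 7 * n + 5.
have := @eval_for #7 #8 (Seq (For #9 #10 matrix_row) (Seq (For #5 #6 (transfer #1 #2)) (Move #4 #3)))
  n B (fun=> rg true)
  (fun i => Stacks si (map eb (drop (i * n) w)) (rs (take (i * n) w)) (map eb w) [::]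
    (nseq n u) [::] (nseq n u) [::] (nseq n u) [::] [::] (rs (lex_bits i)) sl srow sbest scb scb2 sp)
  (rg b) isT erefl.
rewrite /= -size_w take_size drop_size mul0n drop0 take0 => H.
apply: (eval_weaken (H _)); last by rewrite /square_cost /B; lia.
move=> a0 an {H}; exists false; apply: eval_conv.
- apply: eval_seq.
    have := @eval_for #9 #10 matrix_row n (n * (10 * n + 33) + 11) (fun=> rg true)
     (fun i => Stacks si (map eb (drop (a0 * n) w)) (rs (take (a0 * n) w)) (map eb (drop (i * n) w))
      (rs (take (i * n) w)) (nseq n u) [::] (nseq (n - a0.+1) u) (nseq a0 u) (nseq n u) [::] [::]
      (rs (lex_bits a0 ++ lex_rows a0 i)) sl srow sbest scb scb2 sp)
     (rg true) isT erefl.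
    rewrite /= mul0n drop0 take0 cats0 -size_w take_size drop_size; apply=> b0 bn; exists false.
    rewrite lex_rowsS catA.
    exact: eval_matrix_row.
  apply: eval_seq.
    have := @eval_for #5 #6 (transfer #1 #2) n 3 (fun=> rg true)
     (fun i => Stacks si (map eb (drop (a0 * n + i) w)) (rs (take (a0 * n + i) w)) [::]
       (rs w) (nseq n u) [::] (nseq (n - a0.+1) u) (nseq a0 u) (nseq n u) [::] [::]
       (rs (lex_bits a0.+1)) sl srow sbest scb scb2 sp) (rg false) isT erefl.
    rewrite /= addn0 lex_bitsS; apply=> i ik; exists false.
    by rewrite addnS; apply/eval_transfer_fwd/index_lt.
  rewrite -lex_bitsS; exact: (@eval_move #4 #3 (rg false)
     (Stacks si (map eb (drop (a0 * n + n) w)) (rs (take (a0 * n + n) w)) [::]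
       (rs w) (nseq n u) [::] (nseq (n - a0.+1) u) (nseq a0 u) (nseq n u) [::] [::]
       (rs (lex_bits a0.+1)) sl srow sbest scb scb2 sp) (rs w) [::] isT).
- by rewrite size_rev size_map size_w /B; lia.
- by [].
by rewrite /= revK cats0 mulSn addnC.
Qed.

End Generate.

(** * Simulating the given machine *)

Definition running (r : reg) : bool := let: (q, x, _) := r in tm_delta q x.
Definition mv_right (r : reg) : bool :=
  let: (q, x, _) := r in if tm_delta q x is Some (_, _, m) then m else false.
Definition written (r : reg) : Sy :=
  let: (q, x, _) := r in if tm_delta q x is Some (_, y, _) then y else x.
Definition next (r : reg) (o : option Sy) : reg :=
  let: (q, x, f) := r in
  (if tm_delta q x is Some (q', _, _) then q' else q, odflt u o, f).

(** The register holds the state of [M] and the symbol under its head. A move pushes the written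
    symbol on the half tape left behind and pops the other half, an empty half giving a blank. *)
Definition sim_step : prog := If mv_right (Seq (Push #13 written) (Pop #0 next))
  (Seq (Push #0 written) (Pop #13 next)).
(** The last [PushX] returns the symbol under the head, so that stack 0 ends as the tape from the
    head on, which is what [output] decodes. *)
Definition simulate : prog := Seq (PopX #0) (Seq (While running sim_step) (PushX #0)).

Section Simulate.
Variables (f : bool * bool * bool * bool).
Variables (w w2 v v2 k k2 xa al xb bl t o row best cb cb2 p : seq Sy).
Notation Sim l r := (Stacks r w w2 v v2 k k2 xa al xb bl t o l row best cb cb2 p).

Lemma eval_sim_loop m (c : config M) : halted (run m c) ->
  eval (While running sim_step) (c.1, thd c.2, f) (Sim (tl c.2) (tr c.2)) (2 * m)
    ((run m c).1, thd (run m c).2, f) (Sim (tl (run m c).2) (tr (run m c).2)).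
Proof.
elim: m c => [|m IH] [q [l x r]].
  rewrite /halted /=; case e: (tm_delta q x) => [[[q' y] mv]|] //= _.
  by apply: EWhileF; rewrite /= e.
rewrite /halted /=; case e: (tm_delta q x) => [[[q' y] mv]|] /= h; last first.
  by apply: EWhileF; rewrite /= e.
have {}IH := IH _ h; apply: (eval_weaken (n := 2 + 2 * m)); last by lia.
move: IH; case: mv {h} e => e IH; (apply: EWhileT (leqnn _); first by rewrite /= e).
- by apply: EIf; rewrite /= e; apply: eval_seq_push; exact: (EPop _ _ _ _ 0).
- by move: IH; rewrite /= e; case: r.
- by apply: EIf; rewrite /= e; apply: eval_seq_push; exact: (EPop _ _ _ _ 0).
by move: IH; rewrite /= e; case: l.
Qed.

End Simulate.

(** Only [decode s0 = y] is known of the final stack: arbitrary symbols may follow the output, and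
    [y] may have any length. *)
Lemma eval_simulate w w2 v v2 k k2 xa al xb bl t o row best cb cb2 p m z y b e a g :
  halts_within M z m y ->
  exists q' x' b' l' s0, decode s0 = y /\
  eval simulate (tm_start M, u, (b, e, a, g))
    (Stacks (map eb z) w w2 v v2 k k2 xa al xb bl t o [::] row best cb cb2 p) (2 * m + 2)
    (q', x', (b', e, a, g)) (Stacks s0 w w2 v v2 k k2 xa al xb bl t o l' row best cb cb2 p).
Proof.
move=> [hm ym]; pose f : bool * bool * bool * bool := (isSome (ohead (map eb z)), e, a, g).
have := eval_sim_loop f w w2 v v2 k k2 xa al xb bl t o row best cb cb2 p hm.
have -> : (init M z).1 = tm_start M by [].
have -> : thd (init M z).2 = odflt u (ohead (map eb z)) by case: (z).
have -> : tl (init M z).2 = [::] by case: (z).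
have -> : tr (init M z).2 = behead (map eb z) by case: (z).
case: (run m (init M z)) ym => q' [l' x' r'] /= ym h.
exists q', x', f.1.1.1, l', (x' :: r'); split=> //.
apply: eval_conv; first (apply: eval_seq_pop; apply: eval_seq; last exact: (EPush _ _ _ _ 0)).
- exact: h.
- by lia.
- by [].
- by [].
Qed.

(** * Extracting the best row from the output *)

Definition isbit (o : option Sy) := (o == Some (eb false)) || (o == Some (eb true)).
(** Flag [e] is raised at the first non-bit and stays up; from then on every read gives false,
    matching the default of [nth false] in [dec_set]. *)
Definition read (r : reg) (o : option Sy) : reg :=
  let: (q, x, (b, e, a, g)) := r in let ok := ~~ e && isbit o in
  let v := ok && (o == Some (eb true)) in (q, eb v, (b, ~~ ok, a || v, g)).
Definition isone (r : reg) : bool := getx r == eb true.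
Definition getg (r : reg) : bool := let: (q, x, (b, e, a, g)) := r in g.
(** Each one of the current row uses up a mark of the best count; finding that stack empty means
    that the row has more ones. *)
Definition count_reg (r : reg) (o : option Sy) : reg :=
  let: (q, x, (b, e, a, g)) := r in (q, x, (b, e, a, g || ~~ o)).
Definition any_bit (r : reg) : Sy := let: (q, x, (b, e, a, g)) := r in eb a.

Definition read_bit : prog := Seq (Pop #0 read) (Seq (PushX #14)
  (Seq (If isone (Seq (Pop #16 count_reg) (Mark #17)) (Skip _ _ _)) Norm)).
Definition process_row : prog := Seq (For #5 #6 read_bit) (Seq (MoveMarks #17 #16)
  (If getg (Seq (Clear #15) (Seq (Move #14 #15)
              (SetReg (fun '(q, x, (b, e, a, g)) => (q, x, (b, e, a, false))))))
    (Clear #14))).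
Definition push_any : prog := Seq (Push #18 any_bit)
  (SetReg (fun '(q, x, (b, e, a, g)) => (q, x, (b, e, false, g)))).
(** The bits telling which copies are met are put on top of stack 0 and processed as one further
    row, so that a single comparison serves fibers and shadow. The flag [e] is lowered first, since
    the output of [M] may have ended early. *)
Definition extract : prog := Seq Norm (Seq (For #7 #8 (Seq process_row push_any))
  (Seq (Move #18 #0) (Seq (SetReg (fun '(q, x, (b, e, a, g)) => (q, x, (b, false, a, g))))
    (Seq process_row (Seq (Clear #0) (Move #15 #0)))))).

Lemma enc_bit_inj : injective eb.
Proof. by move=> [] [] // /(congr1 val); rewrite /= !inordK. Qed.

Lemma decode_onth (s : seq Sy) i : i < size (decode s) ->
  onth s i = Some (eb (nth false (decode s) i)).
Proof.
elim: s i => [|x s IH] [|i] //=; case: eqP => [x1|_] /=.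
- by move=> _; congr Some; apply: val_inj; rewrite /= x1 inordK.
- case: eqP => //= x2 _; congr Some; apply: val_inj; by rewrite /= x2 inordK.
- exact: IH.
by case: eqP => //= _; exact: IH.
Qed.

Lemma decode_stop (s : seq Sy) : isbit (onth s (size (decode s))) = false.
Proof.
elim: s => [|x s IH] //=; case: eqP => [_|x1] //=; case: eqP => [_|x2] //=.
apply/norP; split; apply/eqP => -[/(congr1 val)]; rewrite /= inordK //.
Qed.

Lemma decode_cat p (s : seq Sy) : decode (map eb p ++ s) = p ++ decode s.
Proof. by elim: p => [|[] p IH] //=; rewrite inordK //= IH. Qed.

Lemma ohead_drop i (s : seq Sy) : ohead (drop i s) = onth s i.
Proof. by elim: s i => [|x s IH] [|i] //=. Qed.

Lemma behead_drop i (s : seq Sy) : behead (drop i s) = drop i.+1 s.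
Proof. by rewrite -drop1 drop_drop. Qed.

(** After [i] reads the flag is [size y < i]: the end of the output is noticed only when position
    [size y] itself is read. *)
Lemma read_decode (s : seq Sy) i q x b a g : let y := decode s in
  read (q, x, (b, size y < i, a, g)) (onth s i) =
  (q, eb (nth false y i), (b, size y < i.+1, a || nth false y i, g)).
Proof.
rewrite /= ltnS; case: (ltngtP i (size (decode s))) => [lt|gt|->] /=.
- rewrite decode_onth // /isbit /= !(inj_eq (@Some_inj _)) !(inj_eq enc_bit_inj).
  by case: (nth _ _ _).
- by rewrite nth_default // ltnW.
- by rewrite decode_stop nth_default.
Qed.

Definition better (best row : seq bool) := if count_mem true best < count_mem true row then row else best.

Section Extract.
Variables (q : 'I_(tm_k M).+1) (w w2 v v2 xb bl t o l : seq Sy) (n : nat).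
Notation Ex s k k2 xa al row best cb cb2 p :=
  (Stacks s w w2 v v2 k k2 xa al xb bl t o l row best cb cb2 p).

Definition bits_from y i := mkseq (fun j => nth false y (i + j)).

Lemma eval_read_bit s i j b k k2 xa al bst c a g p : let y := decode s in
  let pre := bits_from y i in
  eval read_bit (q, u, (b, size y < i + j, a || (true \in pre j), g || (c < count_mem true (pre j))))
    (Ex (drop (i + j) s) k k2 xa al (rs (pre j)) bst
      (nseq (c - count_mem true (pre j)) u) (nseq (count_mem true (pre j)) u) p) 5
    (q, u, (false, size y < i + j.+1, a || (true \in pre j.+1), g || (c < count_mem true (pre j.+1))))
    (Ex (drop (i + j.+1) s) k k2 xa al (rs (pre j.+1)) bst
      (nseq (c - count_mem true (pre j.+1)) u) (nseq (count_mem true (pre j.+1)) u) p).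
Proof.
move=> y pre.
have -> : pre j.+1 = rcons (pre j) (nth false y (i + j)) by rewrite /pre /bits_from mkseqS.
rewrite rs_rcons mem_rcons in_cons -cats1 count_cat /= addn0 addnS; move: (pre j) => P.
apply: eval_seq_pop; rewrite ohead_drop read_decode -/y behead_drop.
apply: eval_seq_push; rewrite /=.
case: (nth false y (i + j)) => /=.
- apply: eval_conv; first apply: eval_seq; [|exact: (EPop _ _ _ _ 0)|..].
  + by apply: EIf; rewrite /isone /= eqxx; apply: eval_seq_pop; exact: (EPush _ _ _ _ 0).
  + by [].
  + rewrite /= addn1 ltnS !orbT; do !congr pair.
    (* The stack is found empty exactly when the earlier ones of the row have used up all [c]
       marks. *)
    rewrite (_ : ~~ _ = (c <= count_mem true P)); last first.
      by rewrite -subn_eq0; case: (c - _).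
    by rewrite -orbA; congr (_ || _); rewrite ltnS; apply: orb_idl => /ltnW.
  + by rewrite /= addn1 behead_nseq subnS.
- apply: eval_conv; first apply: eval_seq; [|exact: (EPop _ _ _ _ 0)|..].
  + apply: EIf; rewrite /isone /= (inj_eq enc_bit_inj) /=; exact: (ESkip _ _ _ 0).
  + by [].
  + by rewrite /= !addn0 !orbF.
  + by rewrite /= !addn0.
Qed.

Lemma eval_process_row s i b xa al best a p : let y := decode s in
  let row := bits_from y i n in size best <= n ->
  eval process_row (q, u, (b, size y < i, a, false))
    (Ex (drop i s) (nseq n u) [::] xa al [::] (map eb best) (nseq (count_mem true best) u) [::] p)
    (14 * n + 6)
    (q, u, (false, size y < i + n, a || (true \in row), false))
    (Ex (drop (i + n) s) (nseq n u) [::] xa al [::] (map eb (better best row))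
       (nseq (count_mem true (better best row)) u) [::] p).
Proof.
move=> y row bn; set c := count_mem true best; pose pre := bits_from y i.
have srow : size row = n by rewrite size_mkseq.
have crow : count_mem true row <= n by rewrite -srow count_size.
(* By truncated subtraction the merged counter is the maximum of the two counts, hence the count of
   the better row. *)
pose S3 := Ex (drop (i + n) s) (nseq n u) [::] xa al (rs row) (map eb best)
       (nseq (count_mem true row + (c - count_mem true row)) u) [::] p.
have Hif : eval (If getg (Seq (Clear #15) (Seq (Move #14 #15)
              (SetReg (fun '(q, x, (b, e, a, g)) => (q, x, (b, e, a, false))))))
    (Clear #14)) (q, u, (false, size y < i + n, a || (true \in row), c < count_mem true row)) S3
    (3 * n + 3) (q, u, (false, size y < i + n, a || (true \in row), false))
    (Ex (drop (i + n) s) (nseq n u) [::] xa al [::] (map eb (better best row))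
       (nseq (count_mem true (better best row)) u) [::] p).
  apply: EIf; rewrite /getg /better /S3 -/c; case: ltnP => lt.
    rewrite (_ : count_mem true row + _ = count_mem true row); last by lia.
    apply: eval_conv.
    - apply: eval_seq.
        exact: (eval_clear #15 _ (Ex (drop (i + n) s) (nseq n u) [::] xa al (rs row) (map eb best)
                 (nseq (count_mem true row) u) [::] p) (map eb best)).
      apply: eval_seq; last exact: (EPop _ _ _ _ 0).
      exact: (@eval_move #14 #15 _ (Ex (drop (i + n) s) (nseq n u) [::] xa al (rs row) [::]
                 (nseq (count_mem true row) u) [::] p) (rs row) [::] isT).
    - by rewrite size_rev !size_map ?size_iota; lia.
    - by [].
    - by rewrite /= revK cats0.
  rewrite (_ : count_mem true row + _ = c); last by lia.
  apply: eval_conv.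
  - exact: (eval_clear #14 _ (Ex (drop (i + n) s) (nseq n u) [::] xa al (rs row) (map eb best)
                 (nseq c u) [::] p) (rs row)).
  - by rewrite size_rev !size_map ?size_iota; lia.
  - by [].
  - by [].
apply: eval_weaken.
  apply: eval_seq.
    have := @eval_for #5 #6 read_bit n 5
      (fun j => (q, u, (true, size y < i + j, a || (true \in pre j), false || (c < count_mem true (pre j)))))
      (fun j => Ex (drop (i + j) s) (nseq n u) [::] xa al (rs (pre j)) (map eb best)
        (nseq (c - count_mem true (pre j)) u) (nseq (count_mem true (pre j)) u) p)
      (q, u, (b, size y < i, a, false)) isT.
    cbv beta; rewrite addn0 /setb orbF => /(_ erefl) H.
    rewrite (_ : nseq c u = nseq (c - count_mem true (pre 0)) u); last by rewrite subn0.
    apply: H => j jn; exists false; exact: eval_read_bit.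
  apply: eval_seq Hif.
  exact: (@eval_move_marks #17 #16
     (q, u, (false, size y < i + n, a || (true \in row), c < count_mem true row))
     (Ex (drop (i + n) s) (nseq n u) [::] xa al (rs row) (map eb best) [::] [::] p)
     (count_mem true row) (c - count_mem true row) isT).
by lia.
Qed.

Definition marks y k := mkseq (fun i => true \in bits_from y (i * n) n) k.
Definition best_row y k := foldl better [::] (mkseq (fun i => bits_from y (i * n) n) k).
Definition choose_bits y := better (best_row y n) (marks y n).

Lemma best_rowS y k : best_row y k.+1 = better (best_row y k) (bits_from y (k * n) n).
Proof. by rewrite /best_row mkseqS foldl_rcons. Qed.

Lemma size_best_row y k : size (best_row y k) <= n.
Proof.
elim: k => [//|k IH]; rewrite best_rowS /better.
by case: ifP => _ //; rewrite size_mkseq.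
Qed.

Lemma size_marks y k : size (marks y k) = k.
Proof. exact: size_mkseq. Qed.

Lemma marksS y k : marks y k.+1 = rcons (marks y k) (true \in bits_from y (k * n) n).
Proof. exact: mkseqS. Qed.

Lemma size_choose_bits y : size (choose_bits y) <= n.
Proof. by rewrite /choose_bits /better; case: ifP => _; rewrite ?size_marks ?size_best_row. Qed.

Lemma eval_extract s x b m : let y := decode s in size s <= m ->
  eval extract (q, x, (b, false, false, false))
    (Ex s (nseq n u) [::] (nseq n u) [::] [::] [::] [::] [::] [::])
    (n * (14 * n + 12) + 18 * n + m + 13)
    (q, u, (false, false, true \in marks y n, false))
    (Ex (rs (choose_bits y)) (nseq n u) [::] (nseq n u) [::] [::] [::]
      (nseq (count_mem true (choose_bits y)) u) [::] [::]).
Proof.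
move=> y sm; set mk := marks y n; have smk : size mk = n := size_marks y n.
(* Stack 0 before the last row: the marks, then what is left of the tape of [M]. It decodes to at
   least [n] bits, so the end flag stays down. *)
pose s2 := map eb mk ++ drop (n * n) s.
have y2 : bits_from (decode s2) 0 n = mk.
  rewrite /s2 decode_cat; apply: (@eq_from_nth _ false); first by rewrite size_mkseq smk.
  by move=> j; rewrite size_mkseq => jn; rewrite nth_mkseq // add0n nth_cat smk jn.
have e2 : (size (decode s2) < 0 + n) = false.
  by rewrite /s2 decode_cat size_cat smk; lia.
have d2 : drop (0 + n) s2 = drop (n * n) s.
  by rewrite add0n /s2 drop_size_cat // size_map.
apply: eval_conv.
- apply: eval_seq_pop; apply: eval_seq.
    have := @eval_for #7 #8 (Seq process_row push_any) n (14 * n + 6 + 2)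
      (fun i => (q, u, (true, size y < i * n, false, false)))
      (fun i => Ex (drop (i * n) s) (nseq n u) [::] [::] [::] [::] (map eb (best_row y i))
        (nseq (count_mem true (best_row y i)) u) [::] (rs (marks y i)))
      (q, u, (false, false, false, false)) isT.
    cbv beta; rewrite mul0n ltn0 drop0 => /(_ erefl) H; apply: H => i ik; exists false.
    rewrite marksS best_rowS (mulSn i) (addnC n (i * n)); apply: eval_conv.
    + apply: eval_seq.
        exact: (eval_process_row s (i * n) true (nseq (n - i.+1) u) (nseq i u) false
                  (rs (marks y i)) (size_best_row y i)).
      by apply: eval_seq_push; exact: (EPop _ _ _ _ 0).
    + by [].
    + by [].
    + by rewrite rs_rcons.
  apply: eval_seq.
    exact: (@eval_move #18 #0 _ (Ex (drop (n * n) s) (nseq n u) [::] (nseq n u) [::] [::]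
        (map eb (best_row y n)) (nseq (count_mem true (best_row y n)) u) [::] (rs mk))
        (rs mk) (drop (n * n) s) isT).
  apply: eval_seq_pop; apply: eval_seq.
    rewrite /= revK.
    have := eval_process_row s2 0 false (nseq n u) [::] false [::] (size_best_row y n).
    by rewrite drop0; apply.
  rewrite e2 y2 d2 orFb -/(choose_bits y); apply: eval_seq.
    exact: (eval_clear #0 _ (Ex (drop (n * n) s) (nseq n u) [::] (nseq n u) [::] [::]
        (map eb (choose_bits y)) (nseq (count_mem true (choose_bits y)) u) [::] [::])
        (drop (n * n) s)).
  exact: (@eval_move #15 #0 _ (Ex [::] (nseq n u) [::] (nseq n u) [::] [::]
        (map eb (choose_bits y)) (nseq (count_mem true (choose_bits y)) u) [::] [::])
        (map eb (choose_bits y)) [::] isT).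
- rewrite size_drop size_rev !size_map ?size_iota; have := size_choose_bits y.
  have cn := leq_trans (leq_subr (n * n) (size s)) sm.
  by rewrite -!(addnA (14 * n)); move: (n * _) (size s - _) cn; lia.
- by [].
- by rewrite /= cats0.
Qed.

End Extract.

(** * The complete program *)

Definition program : prog :=
  Seq load (Seq isqrt (Seq square (Seq (Move #12 #0) (Seq simulate extract)))).

Definition program_cost n k m := 4 * (n * n) + n * (6 * n + 6) + square_cost n + 2 * k +
  2 * m + (n * (14 * n + 12) + 18 * n + (k + (2 * m + 2)) + 13) + 6.

Lemma eval_program w n m y : size w = n * n -> halts_within M (lex_bits w n n) m y ->
  exists r' s', eval program (tm_start M, u, (false, false, false, false))
      (Stacks (rs w) [::] [::] [::] [::] [::] [::] [::] [::] [::] [::] [::] [::] [::] [::] [::] [::] [::] [::])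
      (program_cost n (size (lex_bits w n n)) m) r' s' /\
    nth [::] s' 0 = rs (choose_bits n y).
Proof.
move=> sw hm; set z := lex_bits w n n in hm *.
have [q' [x' [b' [l' [s0 [s0y hs]]]]]] := eval_simulate [::] (rs w) (map eb w) [::]
  (nseq n u) [::] (nseq n u) [::] (nseq n u) [::] [::] [::] [::] [::] [::] [::] [::]
  false false false false hm.
(* Bounds what the simulation leaves on stack 0, which [extract] has to clear. *)
have ss := eval_height 0 hs; rewrite /= size_map in ss.
do 2 eexists; split.
  apply: eval_weaken; first apply: eval_seq.
  - rewrite -map_rev.
    exact: (eval_load [::] [::] [::] [::] [::] [::] (rev w) [::] [::] [::]).
  - apply: eval_seq.
      have := @eval_isqrt (tm_start M) false false false [::] [::] [::] [::] [::] [::] [::]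
        (map eb w) (map eb w) n 0 n false (add0n n).
      by rewrite muln0 subn0 -sw !cats0 map_rev revK size_rev; apply.
    apply: eval_seq; first exact: eval_square.
    apply: eval_seq.
      exact: (@eval_move #12 #0 _ (Stacks [::] [::] (rs w) (map eb w) [::] (nseq n u) [::] (nseq n u) [::]
        (nseq n u) [::] [::] (rs z) [::] [::] [::] [::] [::] [::]) (rs z) [::] isT).
    rewrite /= revK cats0; apply: eval_seq; first exact: hs.
    exact: eval_extract ss.
  by rewrite /program_cost !size_rev !size_map sw; lia.
by rewrite /= s0y.
Qed.

End Macros.

(* Reals makes [^] denote Nat.pow on nat, also in the definitions. *)
Local Notation "m ^ n" := (expn m n) : nat_scope.

Lemma pow_expn m n : Nat.pow m n = m ^ n.
Proof. by elim: n => [|n IH] //=; rewrite IH expnS. Qed.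

(** * Polynomial bounds *)

Section PolynomialBounds.

(** A base of at least 2 lets the exponent absorb constants and sums, so that a bound is a single
    number. *)
Definition poly_bounded (f : nat -> nat) := exists c, forall n, f n <= n.+2 ^ c.

Lemma poly_bounded_le f f' : (forall n, f n <= f' n) -> poly_bounded f' -> poly_bounded f.
Proof. by move=> le [c h]; exists c => n; exact: leq_trans (le n) (h n). Qed.

Lemma poly_bounded_const k : poly_bounded (fun=> k).
Proof.
exists k => n; apply: leq_trans (ltnW (ltn_expl k (isT : 1 < 2))) _.
by case: k => // k; rewrite leq_exp2r.
Qed.

Lemma poly_bounded_id : poly_bounded (fun n => n).
Proof. by exists 1 => n; rewrite expn1; lia. Qed.

Lemma poly_bounded_add f f' :
  poly_bounded f -> poly_bounded f' -> poly_bounded (fun n => f n + f' n).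
Proof.
move=> [c h] [c' h']; exists (c + c').+1 => n.
apply: leq_trans (leq_add (h n) (h' n)) _; rewrite expnS.
apply: leq_trans (_ : 2 * n.+2 ^ (c + c') <= _); last by rewrite leq_mul2r orbT.
by rewrite mul2n -addnn leq_add // leq_pexp2l // ?leq_addr ?leq_addl.
Qed.

Lemma poly_bounded_mul f f' :
  poly_bounded f -> poly_bounded f' -> poly_bounded (fun n => f n * f' n).
Proof. by move=> [c h] [c' h']; exists (c + c') => n; rewrite expnD leq_mul. Qed.

Lemma poly_bounded_exp f k : poly_bounded f -> poly_bounded (fun n => f n ^ k).
Proof.
move=> pf; elim: k => [|k IH].
  by apply: poly_bounded_le (poly_bounded_const 1) => n; rewrite expn0.
by apply: poly_bounded_le (poly_bounded_mul pf IH) => n; rewrite expnS.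
Qed.

(** For positive [n] one has [n + 2 <= 3 * n]; the resulting factor [3 ^ c] serves as constant and,
    being at least [c], as exponent. The added constant covers [n = 0]. *)
Lemma poly_bounded_square f : poly_bounded f ->
  exists c, forall n, f n <= c * (n * n) ^ c + c.
Proof.
move=> [c h]; exists (3 ^ c) => -[|n].
  apply: leq_trans (h 0) (leq_trans _ (leq_addl _ _)).
  by case: c {h} => // c; rewrite leq_exp2r.
apply: leq_trans (h n.+1) (leq_trans _ (leq_addr _ _)).
apply: leq_trans (_ : (3 * n.+1) ^ c <= _).
  by case: c {h} => // c; rewrite leq_exp2r //; lia.
rewrite expnMn leq_mul2l; apply/orP; right.
apply: leq_trans (_ : (n.+1 * n.+1) ^ c <= _).
  by case: c {h} => // c; rewrite leq_exp2r //; nia.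
by rewrite leq_pexp2l // ltnW // ltn_expl.
Qed.

End PolynomialBounds.

Ltac poly := repeat first [ exact: poly_bounded_const | exact: poly_bounded_id
  | apply: poly_bounded_exp | apply: poly_bounded_add | apply: poly_bounded_mul ].

(** * Bit strings of graphs *)

Section Encoding.

Lemma enc_graphE n (e : rel 'I_n) (f : nat -> nat -> bool) :
  (forall i j : 'I_n, e i j = f i j) ->
  enc_graph e = flatten [seq [seq f i j | j <- iota 0 n] | i <- iota 0 n].
Proof.
move=> ef; rewrite /enc_graph -val_enum_ord -map_comp; congr flatten.
by apply: eq_map => i /=; rewrite -map_comp; apply: eq_map => j /=.
Qed.

Lemma flatten_iota_mul (T : Type) (F : nat -> T) m n :
  flatten [seq [seq F (i * n + j) | j <- iota 0 n] | i <- iota 0 m] =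
  [seq F k | k <- iota 0 (m * n)].
Proof.
elim: m => [|m IH]; first by rewrite mul0n.
have -> : iota 0 m.+1 = iota 0 m ++ [:: m] by rewrite -addn1 iotaD.
rewrite map_cat flatten_cat IH /= cats0 mulSn (addnC n) iotaD map_cat add0n.
by rewrite (_ : iota (m * n) n = map (addn (m * n)) (iota 0 n)) -?map_comp // -iotaDl addn0.
Qed.

Lemma map_const (T T' : Type) (x : T') (s : seq T) : [seq x | _ <- s] = nseq (size s) x.
Proof. by elim: s => //= y s ->. Qed.

Lemma flatten2 (T : Type) (s : seq (seq (seq T))) :
  flatten (flatten s) = flatten [seq flatten x | x <- s].
Proof. by elim: s => [|x s IH] //=; rewrite flatten_cat IH. Qed.

Lemma enc_graph_map n (e : rel 'I_n) : exists2 f : nat -> nat -> bool,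
  forall i j : 'I_n, e i j = f i j &
  enc_graph e = [seq f (k %/ n) (k %% n) | k <- iota 0 (n * n)].
Proof.
pose f (i j : nat) := if (insub i : option 'I_n) is Some a then
  if (insub j : option 'I_n) is Some b then e a b else false else false.
have ef (i j : 'I_n) : e i j = f i j by rewrite /f !valK.
exists f => //; rewrite (enc_graphE ef) -flatten_iota_mul; congr flatten.
apply/eq_in_map => i; rewrite mem_iota => /andP[_ iN]; apply/eq_in_map => j.
rewrite mem_iota => /andP[_ jn]; have n0 : 0 < n by lia.
by rewrite divnMDl // divn_small // addn0 modnMDl modn_small.
Qed.

Lemma size_enc_graph n (e : rel 'I_n) : size (enc_graph e) = n * n.
Proof. by have [f _ ->] := enc_graph_map e; rewrite size_map size_iota. Qed.

Lemma nth_enc_graph n (e : rel 'I_n) (i j : 'I_n) :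
  nth false (enc_graph e) (i * n + j) = e i j.
Proof.
have [f ef ->] := enc_graph_map e; have lt := pair_ord_subproof i j.
have n0 : 0 < n := leq_ltn_trans (leq0n i) (ltn_ord i).
rewrite (nth_map 0) ?size_iota // nth_iota // add0n ef.
by rewrite divnMDl // divn_small // addn0 modnMDl modn_small.
Qed.

(** In row (a, b), the entry at column (c, e) with [c] different from [a] does not depend on [e],
    which gives constant blocks. At [c = a] irreflexivity removes the first disjunct and leaves row
    [b] of the graph. *)
Lemma enc_lex_adj n (adj : rel 'I_n) : is_graph adj ->
  enc_graph (lex_adj adj) = lex_bits (enc_graph adj) n n.
Proof.
move=> [_ ir]; set w := enc_graph adj; pose A i j := nth false w (i * n + j).
pose f k l := A (k %/ n) (l %/ n) || (k %/ n == l %/ n) && A (k %% n) (l %% n).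
have ef (i j : 'I_(n * n)) : lex_adj adj i j = f i j.
  rewrite /lex_adj /f /A -[i %/ n]/(val (fst_ord i)) -[j %/ n]/(val (fst_ord j)).
  rewrite -[i %% n]/(val (snd_ord i)) -[j %% n]/(val (snd_ord j)).
  by rewrite !nth_enc_graph val_eqE.
rewrite (enc_graphE ef) -(flatten_iota_mul _ n n) flatten2 -map_comp; congr flatten.
apply/eq_in_map => a; rewrite mem_iota => /andP[_ an] /=.
rewrite /lex_rows; congr flatten; apply/eq_in_map => b; rewrite mem_iota => /andP[_ bn] /=.
have n0 : 0 < n by lia.
have E c e : c < n -> e < n -> f (a * n + b) (c * n + e) = A a c || (a == c) && A b e.
  by move=> cn en; rewrite /f !divnMDl // !divn_small // !addn0 !modnMDl !modn_small.
pose G c := [seq f (a * n + b) (c * n + e) | e <- iota 0 n].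
rewrite -(flatten_iota_mul _ n n) -[X in flatten X = _]/(map G (iota 0 n)).
have -> : iota 0 n = iota 0 a ++ iota a 1 ++ iota a.+1 (n - a.+1).
  by rewrite -[a.+1]addn1 -iotaD -{2}[a]add0n -iotaD; congr iota; lia.
have other c : c < n -> c != a ->
    G c = nseq n (nth false w (a * n + c)).
  move=> cn ca; transitivity [seq nth false w (a * n + c) | _ <- iota 0 n]; last first.
    by rewrite map_const size_iota.
  apply/eq_in_map => e.
  by rewrite mem_iota => /andP[_ en]; rewrite E // eq_sym (negbTE ca) orbF.
rewrite !map_cat !flatten_cat; congr (_ ++ (_ ++ _)).
- congr flatten; apply/eq_in_map => c; rewrite mem_iota => /andP[_ ca].
  by apply: other; lia.
- rewrite /= cats0 /G; apply: (@eq_from_nth _ false).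
    rewrite size_map size_iota size_takel // size_drop size_enc_graph.
    by have : b.+1 * n <= n * n; [rewrite leq_mul2r bn orbT | rewrite mulSn; lia].
  move=> e; rewrite size_map size_iota => en.
  rewrite (nth_map 0) ?size_iota // nth_iota // add0n E // eqxx nth_take // nth_drop.
  by have -> : A a a = false by exact: etrans (nth_enc_graph adj (Ordinal an) (Ordinal an)) (ir _).
congr flatten; apply/eq_in_map => c; rewrite mem_iota => /andP[ac cn].
by apply: other; lia.
Qed.

End Encoding.

(** * The set read off the chosen bits *)

Section BestIndependentSet.

Lemma card_dec_set n y : size y <= n -> #|dec_set n y| = count_mem true y.
Proof.
move=> yn; rewrite -sum1dep_card -(big_mkord (fun i => nth false y i) (fun=> 1)).
rewrite (big_cat_nat (n := size y)) //= [X in _ + X = _]big1_seq ?addn0; last first.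
  move=> i /andP[yi]; rewrite mem_index_iota => /andP[le _].
  by rewrite nth_default in yi.
rewrite -sum1_count [RHS](big_nth false); apply: eq_bigl => i.
by rewrite /= eqb_id.
Qed.

Lemma dec_set_bits n (y : seq bool) (a : 'I_n) :
  dec_set n (bits_from y (a * n) n) = fiber (dec_set (n * n) y) a.
Proof. by apply/setP => b; rewrite !inE nth_mkseq. Qed.

Lemma dec_set_marks n (y : seq bool) :
  dec_set n (marks n y n) = shadow (dec_set (n * n) y).
Proof.
apply/setP => a; rewrite !inE nth_mkseq //.
apply/idP/set0Pn => [/mapP[b]|[b]].
  by rewrite mem_iota => /andP[_ bn] e; exists (Ordinal bn); rewrite !inE /= -e.
by rewrite !inE /= => e; apply/mapP; exists (val b); rewrite ?mem_iota ?ltn_ord.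
Qed.

Lemma better_count best row : count_mem true (better best row) =
  maxn (count_mem true best) (count_mem true row).
Proof. by rewrite /better; case: ltnP. Qed.

Lemma better_or best row : better best row = best \/ better best row = row.
Proof. by rewrite /better; case: ifP; auto. Qed.

Lemma best_row_cases n y k : k <= n -> best_row n y k = [::] \/
  exists a : 'I_n, best_row n y k = bits_from y (a * n) n.
Proof.
elim: k => [|k IH] kn; first by left.
rewrite best_rowS; case: (better_or (best_row n y k) (bits_from y (k * n) n)) => ->.
  exact: IH (ltnW kn).
by right; exists (Ordinal kn).
Qed.

Lemma best_row_max n y k i : i < k ->
  count_mem true (bits_from y (i * n) n) <= count_mem true (best_row n y k).
Proof.
elim: k => // k IH; rewrite ltnS leq_eqVlt best_rowS better_count => /orP[/eqP->|/IH h].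
  exact: leq_maxr.
exact: leq_trans h (leq_maxl _ _).
Qed.

Lemma choose_independent n (adj : rel 'I_n) y :
  independent (lex_adj adj) (dec_set (n * n) y) -> independent adj (dec_set n (choose_bits n y)).
Proof.
move=> iy; rewrite /choose_bits; case: (better_or (best_row n y n) (marks n y n)) => ->.
  case: (best_row_cases y (leqnn n)) => [->|[a ->]].
    by apply/independentP => i j; rewrite !inE nth_nil.
  by rewrite dec_set_bits; exact: fiber_independent.
by rewrite dec_set_marks; exact: shadow_independent.
Qed.

Lemma choose_card n y :
  #|dec_set (n * n) y| <= #|dec_set n (choose_bits n y)| * #|dec_set n (choose_bits n y)|.
Proof.
rewrite (card_dec_set (size_choose_bits n y)) better_count.
apply: card_fibers => [|a].
  by rewrite -dec_set_marks card_dec_set ?size_marks // leq_maxr.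
rewrite -dec_set_bits card_dec_set ?size_mkseq //.
by apply: leq_trans (best_row_max n y (ltn_ord a)) (leq_maxl _ _).
Qed.

End BestIndependentSet.

(** * Taking the square root of the approximation ratio, and iterating *)

Lemma approx_le d (beta beta' : R) M : (beta <= beta')%R ->
  poly_approx_indep d beta M -> poly_approx_indep d beta' M.
Proof.
move=> bb [c H]; exists c => n adj gr tw; have [t [y [ty [hy [iy al]]]]] := H n adj gr tw.
exists t, y; do !split => //; apply: Rle_trans al _.
by apply: Rmult_le_compat_r bb; exact: pos_INR.
Qed.

Lemma approx_sqrt d (beta : R) M : (0 <= beta)%R -> poly_approx_indep d beta M ->
  exists M', poly_approx_indep d (sqrt beta) M'.
Proof.
move=> b0 [c H].
pose r0 := (tm_start M, blank M, (false, false, false, false)).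
exists (program_TM (enc_bit M) r0 (program M)).
(* The square has [n * n] vertices, hence an encoding of [N n] bits; [T] inserts the time bound of
   [M] on that encoding into the cost of the program. *)
pose N n := n * n * (n * n).
pose T n := program_cost n (N n) (c * N n ^ c + c).
have [c' Hc'] : exists c', forall n,
    T n * (2 * (n * n + T n) + 8) + 2 * n + 7 <= c' * (n * n) ^ c' + c'.
  by apply: poly_bounded_square; rewrite /T /N /program_cost /square_cost; poly.
exists c' => n adj gr tw.
have gr2 := lex_graph gr; have tw2 := lex_tww gr tw.
have [t [y [ty [hy [iy al]]]]] := H _ _ gr2 tw2.
rewrite size_enc_graph pow_expn in ty; set w := enc_graph adj.
have sw : size w = n * n by exact: size_enc_graph.
have zE : enc_graph (lex_adj adj) = lex_bits w n n by exact: enc_lex_adj.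
have sz : size (lex_bits w n n) = N n by rewrite -zE size_enc_graph.
rewrite zE in hy; have [r' [s' [ev out]]] := eval_program sw hy.
rewrite sz in ev; have costT : program_cost n (N n) t <= T n.
  by rewrite /T /program_cost /N; lia.
have {}ev := eval_weaken ev costT.
have sE (i : 'I_20) : nth [::] (Stacks (rev (map (enc_bit M) w)) [::] [::] [::] [::] [::] [::] [::]
    [::] [::] [::] [::] [::] [::] [::] [::] [::] [::] [::]) i =
    if i == ord0 then rev (map (enc_bit M) w) else [::].
  by case: i; do 20![case=> [//|]].
have [t' tt' ht'] := program_correct (@enc_bit_inj M) sE ev out.
exists t', (choose_bits n y); split; [|split; [exact: ht'|split]].
- rewrite -/w sw pow_expn; apply: leq_trans (Hc' n); apply: leq_trans tt' _.
  by rewrite sw; have := size_choose_bits n y; lia.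
- exact: choose_independent.
set m := #|dec_set n _|.
(* With S the set found in the square: alpha(G)^2 <= alpha(G[G]) <= beta |S| <= beta m^2. *)
have h1 : (INR (alpha adj) * INR (alpha adj) <= beta * (INR m * INR m))%R.
  rewrite -!mult_INR; apply: (Rle_trans _ (INR (alpha (lex_adj adj)))).
    by apply: le_INR; apply/leP; exact: alpha_lex.
  apply: Rle_trans al _; apply: Rmult_le_compat_l b0 _; apply: le_INR; apply/leP.
  exact: choose_card.
have m0 := pos_INR m.
rewrite -(sqrt_square _ (pos_INR (alpha adj))) -[INR m in X in Rle _ X](sqrt_square _ m0).
by rewrite -sqrt_mult //; [exact: sqrt_le_1_alt | exact: Rmult_le_pos].
Qed.

(** Each square root halves the exponent [2 ^ k] of [1 + eps]. The bound [1 <= beta] survives it and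
    supplies the nonnegativity that [approx_sqrt] asks for. *)
Lemma approx_power d (eps : R) k : (0 < eps)%R -> forall (beta : R) M, (1 <= beta)%R ->
  (beta <= pow (1 + eps) (2 ^ k))%R -> poly_approx_indep d beta M ->
  exists M', poly_approx_indep d (1 + eps) M'.
Proof.
move=> e0; elim: k => [|k IH] beta M b1 bk H.
  by exists M; apply: approx_le H; rewrite pow_1 in bk.
have [|M' H'] := approx_sqrt _ H; first by lra.
apply: IH H'.
  by rewrite -sqrt_1; exact: sqrt_le_1_alt.
have p0 : (0 <= pow (1 + eps) (2 ^ k))%R by apply: pow_le; lra.
rewrite -(sqrt_square _ p0) -Rdef_pow_add; apply: sqrt_le_1_alt.
by rewrite -[(2 ^ k + 2 ^ k)%coq_nat]/(2 ^ k + 2 ^ k) addnn -mul2n -expnS.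
Qed.

Theorem mainTheorem16 (d : nat) :
  (exists (beta : R) (M : TM), Rle 1 beta /\ poly_approx_indep d beta M) ->
  forall eps : R, Rlt 0 eps ->
    exists M : TM, poly_approx_indep d (Rplus 1 eps) M.
Proof.
move=> [beta [M [b1 H]]] eps e0.
have [k hk] := INR_unbounded (beta / eps).
apply: (@approx_power d eps k e0 beta M b1 _ H).
(* Bernoulli's inequality, here [poly], bounds [(1 + eps) ^ (2 ^ k)] from below; then
   [2 ^ k >= k > beta / eps] suffices. *)
apply: Rle_trans (_ : 1 + INR (2 ^ k) * eps <= _)%R; last first.
  exact: poly e0.
have hk2 : (INR k <= INR (2 ^ k))%R by apply: le_INR; apply/leP; exact: ltnW (ltn_expl _ _).
have : (beta / eps * eps <= INR (2 ^ k) * eps)%R by apply: Rmult_le_compat_r; lra.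
by rewrite /Rdiv Rmult_assoc Rinv_l ?Rmult_1_r; lra.
Qed.
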